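(* Let $X$ be a mixing sofic shift, let $(G,\pi)$ be the minimal right-resolving presentation of $X$, and let $\Sigma_G$ be the edge shift (shift of finite type) of $G$, with induced factor map $\pi:\Sigma_G\to X$. Then there exists a synchronizing periodic point $p\in X$ such that $\pi^{-1}(p)=\{q\}$ for some $q\in\Sigma_G$ and the map $\pi\times\pi: G^{s}(\Sigma_G,q)\to G^{\mathrm{lcs}}(X,p)$ is an isomorphism of (topological) groupoids. In particular, $C^*(G^{s}(\Sigma_G,q))\cong C^*(G^{\mathrm{lcs}}(X,p))$. Similarly, if $(G',\pi')$ is the minimal left-resolving presentation of $X$, with edge shift $\Sigma_{G'}$, then there exists a synchronizing periodic point $p'\in X$ such that $(\pi')^{-1}(p')=\{q'\}$ for some $q'\in\Sigma_{G'}$ and $\pi'\times\pi':G^{u}(\Sigma_{G'},q')\to G^{\mathrm{lcu}}(X,p')$ is an isomorphism of (topological) groupoids; in particular $C^*(G^{u}(\Sigma_{G'},q'))\cong C^*(G^{\mathrm{lcu}}(X,p'))$.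
   Context: **Shift spaces.** A shift space is a closed, shift-invariant subset $X\subseteq\mathcal A^{\mathbb Z}$ ($\mathcal A$ a finite alphabet), with shift map $\sigma(x)_i=x_{i+1}$. $\mathcal L(X)$ is the set of finite words (including the empty word) occurring in elements of $X$; $\mathcal L_n(X)$ is the set of those of length $n$. $X$ is mixing if for all $w,v\in\mathcal L(X)$ there is $N$ such that for all $n\ge N$ there is $u\in\mathcal L_n(X)$ with $wuv\in\mathcal L(X)$. A word $w\in\mathcal L(X)$ is synchronizing if $uw,wv\in\mathcal L(X)$ implies $uwv\in\mathcal L(X)$; a point is synchronizing if it contains a synchronizing word. The metric on $X$ is $d(x,y)=\inf_{n\ge1}\{2^{-n}: x_i=y_i \text{ for all } |i|<n\}$ if $x_0=y_0$, and $d(x,y)=1$ otherwise. **Sofic shifts.** For a finite directed graph $G=(V,E)$, the edge shift $\Sigma_G\subseteq E^{\mathbb Z}$ is the space of bi-infinite paths. A labelling $\pi:E\to\mathcal A$ induces a map $\pi:\Sigma_G\to\mathcal A^{\mathbb Z}$; a sofic shift is an image $X=\pi(\Sigma_G)$, and $(G,\pi)$ is a presentation of $X$. A presentation is right-resolving (resp. left-resolving) if for each vertex $I$ the map $\pi$ is injective on the edges with source $I$ (resp. with range $I$). It is minimal right-resolving (resp. minimal left-resolving) if it has the fewest vertices among all right-resolving (resp. left-resolving) presentations of $X$; for irreducible sofic shifts this is unique up to isomorphism. **Local conjugacy.** For $x\in X$, $N\ge0$ put $X^{u}(x,N)=\{y\in X: y_n=x_n\ \forall n\le N\}$ and $X^{s}(x,N)=\{y\in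 X:y_n=x_n\ \forall n\ge -N\}$. Write $x\sim_{\mathrm{lcs}}y$ if there are $N,N'\ge0$ and a homeomorphism $\gamma$ from $X^{u}(x,N)$ onto an open subset of $X^{u}(y,N')$ with $\gamma(x)=y$ and $\lim_{n\to\infty}\sup_{z\in X^{u}(x,N)}d(\sigma^n(z),\sigma^n(\gamma(z)))=0$ (such $\gamma$ is a stable local conjugacy). Write $x\sim_{\mathrm{lcu}}y$ if there are $N,N'\ge 0$ and a homeomorphism $\gamma$ from $X^{s}(x,N)$ onto an open subset of $X^{s}(y,N')$ with $\gamma(x)=y$ and $\lim_{n\to\infty}\sup_{z\in X^{s}(x,N)}d(\sigma^{-n}(z),\sigma^{-n}(\gamma(z)))=0$ (an unstable local conjugacy). **Groupoids for $X$.** For a synchronizing periodic point $p\in X$, let $X^{u}(p)=\{x\in X:\exists M\in\mathbb Z,\ x_n=p_n\ \forall n\le M\}$, with topology having basis the sets $\{z\in X: z_n=x_n\ \forall n\le M\}$ ($x\in X^{u}(p)$, $M\in\mathbb Z$), and $X^{s}(p)=\{x\in X:\exists M\in\mathbb Z,\ x_n=p_n\ \forall n\ge M\}$, with the analogous topology with basis $\{z\in X:z_n=x_n\ \forall n\ge M\}$. Then $G^{\mathrm{lcs}}(X,p)=\{(x,y)\in X^{u}(p)\times X^{u}(p): x\sim_{\mathrm{lcs}}y\}$ is an étale groupoid (an equivalence relation) with topology having basis the sets $\{(z,\gamma(z)):z\in X^{u}(x,N)\}$, where $x\in X^{u}(p)$ and $\gamma$ is a stable local conjugacy with domain $X^{u}(x,N)$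 and $\gamma(x)\in X^u(p)$. Likewise $G^{\mathrm{lcu}}(X,p)=\{(x,y)\in X^{s}(p)\times X^{s}(p): x\sim_{\mathrm{lcu}}y\}$, topologized by graphs of unstable local conjugacies. **Groupoids for $\Sigma_G$.** For $a,b\in\Sigma_G$: $a\sim_s b$ iff $a_n=b_n$ for all $n$ sufficiently large, $a\sim_u b$ iff $a_n=b_n$ for all $n$ sufficiently negative. For periodic $q\in\Sigma_G$, $G^{s}(\Sigma_G,q)=\{(a,b): a\sim_u q,\ b\sim_u q,\ a\sim_s b\}$, with topology having basis the sets $\{(z,z')\in \Sigma_G\times\Sigma_G: z_n=a_n \text{ and } z'_n=b_n\ \forall n\le L,\ z_n=z'_n\ \forall n>L\}$, where $(a,b)\in G^s(\Sigma_G,q)$ and $L$ is such that $a_n=b_n$ for all $n>L$. $G^{u}(\Sigma_G,q)$ is defined symmetrically by reversing time: $\{(a,b): a\sim_s q,\ b\sim_s q,\ a\sim_u b\}$ with the mirrored topology. *)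

(* Defs.v *)
From HB Require Import structures.
From mathcomp Require Import all_boot all_order all_algebra.
From mathcomp Require Import sesquilinear.
From mathcomp Require Import complex.
From mathcomp Require Import all_classical all_reals all_analysis.

Set Implicit Arguments.
Unset Strict Implicit.
Unset Printing Implicit Defensive.

Import Order.TTheory GRing.Theory Num.Theory.
Import numFieldNormedType.Exports.

Local Open Scope classical_set_scope.
Local Open Scope ring_scope.

(** * Shift spaces *)

Definition config (A : finType) : topologicalType :=
  prod_topology (fun _ : int => discrete_topology A).

Section Shifts.
Variable A : finType.
Implicit Types (X : set (config A)) (x y z p : config A) (w u v : seq A).

(* The [n]-th power of the shift map, for [n : int]. *)
Definition shiftz (n : int) x : config A := fun i => x (i + n).

Definition word_at x (i : int) (n : nat) : seq A :=
  [seq (x (i + k%:Z) : A) | k <- iota 0 n].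

Definition occurs_in w x : Prop := exists i, w = word_at x i (size w).

(* The empty word belongs to the language of every [X], the empty set included;
   in particular a mixing [X] is nonempty. *)
Definition language X : set (seq A) :=
  [set w | w = [::] \/ exists2 x, X x & occurs_in w x].

Definition mixing X : Prop :=
  forall w v, language X w -> language X v ->
    exists N : nat, forall n : nat, (N <= n)%N ->
      exists u, [/\ size u = n, language X u & language X (w ++ u ++ v)].

Definition synchronizing_word X w : Prop :=
  language X w /\
  forall u v, language X (u ++ w) -> language X (w ++ v) ->
    language X (u ++ w ++ v).

Definition synchronizing_point X p : Prop :=
  exists2 w, synchronizing_word X w & occurs_in w p.

Definition periodic_point p : Prop := exists2 n : nat, (0 < n)%N & shiftz n%:Z p = p.

Definition dist (R : realType) x y : R :=
  if x 0 == y 0 then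
    inf [set 2 ^- n | n in [set n : nat |
           (1 <= n)%N /\ forall i : int, `|i| < n%:Z -> x i = y i]]
  else 1.

Definition asymp_s x y : Prop := exists M : int, forall n, M <= n -> x n = y n.

Definition asymp_u x y : Prop := exists M : int, forall n, n <= M -> x n = y n.

Definition local_u X x (N : nat) : set (config A) :=
  [set y | X y /\ forall n : int, n <= N%:Z -> y n = x n].

Definition local_s X x (N : nat) : set (config A) :=
  [set y | X y /\ forall n : int, - N%:Z <= n -> y n = x n].

End Shifts.

(** * Sofic shifts *)

Record graph := Graph {
  vertex : finType;
  edge : finType;
  src : edge -> vertex;
  tgt : edge -> vertex }.

Definition edge_shift (G : graph) : set (config (edge G)) :=
  [set a | forall i : int, tgt (a i) = src (a (i + 1))].

Arguments edge_shift : clear implicits.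

Definition label_map (A : finType) (G : graph) (pi : edge G -> A)
  (a : config (edge G)) : config A := fun i => pi (a i).

Section Presentations.
Variables (A : finType) (X : set (config A)).

Definition presents (G : graph) (pi : edge G -> A) : Prop :=
  label_map pi @` edge_shift G = X.

Definition sofic : Prop := exists (G : graph) (pi : edge G -> A), presents pi.

Definition right_resolving (G : graph) (pi : edge G -> A) : Prop :=
  forall e e' : edge G, src e = src e' -> pi e = pi e' -> e = e'.

Definition left_resolving (G : graph) (pi : edge G -> A) : Prop :=
  forall e e' : edge G, tgt e = tgt e' -> pi e = pi e' -> e = e'.

Definition minimal_right_resolving (G : graph) (pi : edge G -> A) : Prop :=
  [/\ presents pi, right_resolving pi &
      forall (G' : graph) (pi' : edge G' -> A),
        presents pi' -> right_resolving pi' ->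
        (#|vertex G| <= #|vertex G'|)%N].

Definition minimal_left_resolving (G : graph) (pi : edge G -> A) : Prop :=
  [/\ presents pi, left_resolving pi &
      forall (G' : graph) (pi' : edge G' -> A),
        presents pi' -> left_resolving pi' ->
        (#|vertex G| <= #|vertex G'|)%N].

End Presentations.

(** * Local conjugacy *)

Definition homeo_onto_open (T : topologicalType) (U V : set T) (g : T -> T) :=
  [/\ {within U, continuous g},
      exists2 O : set T, open O & g @` U = V `&` O &
      exists2 h : T -> T, {within g @` U, continuous h} &
        forall z, U z -> h (g z) = z].

Section LocalConjugacy.
Variables (R : realType) (A : finType) (X : set (config A)).
Implicit Types (x y : config A) (N : nat) (g : config A -> config A).

Definition stable_local_conjugacy x N y N' g : Prop :=
  [/\ homeo_onto_open (local_u X x N) (local_u X y N') g,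
      g x = y &
      (fun n : nat => sup [set dist R (shiftz n%:Z z) (shiftz n%:Z (g z)) |
                            z in local_u X x N]) @ \oo --> (0 : R)].

Definition unstable_local_conjugacy x N y N' g : Prop :=
  [/\ homeo_onto_open (local_s X x N) (local_s X y N') g,
      g x = y &
      (fun n : nat => sup [set dist R (shiftz (- n%:Z) z) (shiftz (- n%:Z) (g z)) |
                            z in local_s X x N]) @ \oo --> (0 : R)].

Definition lcs x y : Prop :=
  exists N N' g, stable_local_conjugacy x N y N' g.

Definition lcu x y : Prop :=
  exists N N' g, unstable_local_conjugacy x N y N' g.

End LocalConjugacy.

(** * Topological groupoids given by equivalence relations *)

(* A groupoid whose arrows form an equivalence relation [arrows] on a subset of
   [obj]: [(x, y)] is an arrow with range [x] and source [y], the product of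
   [(x, y)] and [(y, z)] is [(x, z)], the inverse of [(x, y)] is [(y, x)], and
   [x] is a unit when [(x, x)] is an arrow.  [basis] is a basis of the topology
   on the set of arrows. *)
Record eq_groupoid := EqGroupoid {
  obj : choiceType;
  arrows : set (obj * obj);
  basis : set (set (obj * obj)) }.

Arguments arrows : clear implicits.
Arguments basis : clear implicits.

Definition arrow (G : eq_groupoid) : Type := set_type (arrows G).

HB.instance Definition _ (G : eq_groupoid) := Choice.on (arrow G).

Definition arrow_basis (G : eq_groupoid) : set (set (arrow G)) :=
  [set (fun a : arrow G => B (set_val a)) | B in basis G].

Arguments arrow_basis : clear implicits.

(* The library builds a topology from a family of sets without requiring a proof
   that finite intersections are unions of members of the family; when the family
   is a basis this is the topology it is a basis of. *)
HB.instance Definition _ (G : eq_groupoid) :=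
  @isSubBaseTopological.Build (arrow G) (set (arrow G)) (arrow_basis G) id.

(* [c] is the product of the composable arrows [a] and [b]. *)
Definition is_product (G : eq_groupoid) (a b c : arrow G) : Prop :=
  [/\ (set_val a).2 = (set_val b).1,
      (set_val c).1 = (set_val a).1 & (set_val c).2 = (set_val b).2].

Definition groupoid_hom (G H : eq_groupoid) (F : arrow G -> arrow H) : Prop :=
  forall a b c, is_product a b c -> is_product (F a) (F b) (F c).

Definition topological_groupoid_iso (G H : eq_groupoid)
    (F : arrow G -> arrow H) : Prop :=
  exists F' : arrow H -> arrow G,
    [/\ cancel F F', cancel F' F,
        groupoid_hom F /\ groupoid_hom F', continuous F & continuous F'].

(* [f x f] restricts to an isomorphism of topological groupoids [G -> H]. *)
Definition square_is_iso (G H : eq_groupoid) (f : obj G -> obj H) : Prop :=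
  exists F : arrow G -> arrow H,
    (forall a, set_val (F a) = (f (set_val a).1, f (set_val a).2)) /\
    topological_groupoid_iso F.

Section Groupoids.
Variables (R : realType) (A : finType) (X : set (config A)).

Definition unstable_set (p : config A) : set (config A) :=
  [set x | X x /\ asymp_u x p].

Definition stable_set (p : config A) : set (config A) :=
  [set x | X x /\ asymp_s x p].

Definition G_lcs (p : config A) : eq_groupoid :=
  @EqGroupoid (config A)
    [set xy | [/\ unstable_set p xy.1, unstable_set p xy.2
                & lcs R X xy.1 xy.2]]
    [set B | exists x N N' g,
       [/\ unstable_set p x, unstable_set p (g x),
           stable_local_conjugacy R X x N (g x) N' g &
           B = [set (z, g z) | z in local_u X x N]]].

Definition G_lcu (p : config A) : eq_groupoid :=
  @EqGroupoid (config A)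
    [set xy | [/\ stable_set p xy.1, stable_set p xy.2
                & lcu R X xy.1 xy.2]]
    [set B | exists x N N' g,
       [/\ stable_set p x, stable_set p (g x),
           unstable_local_conjugacy R X x N (g x) N' g &
           B = [set (z, g z) | z in local_s X x N]]].

Definition G_s_arrows (q : config A) : set (config A * config A) :=
  [set ab | [/\ unstable_set q ab.1, unstable_set q ab.2
              & asymp_s ab.1 ab.2]].

Definition G_s (q : config A) : eq_groupoid :=
  @EqGroupoid (config A) (G_s_arrows q)
    [set B | exists a b (L : int),
       [/\ G_s_arrows q (a, b), forall n, L < n -> a n = b n &
           B = [set zz | [/\ X zz.1 /\ X zz.2,
                             forall n, n <= L -> zz.1 n = a n /\ zz.2 n = b n &
                             forall n, L < n -> zz.1 n = zz.2 n]]]].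

Definition G_u_arrows (q : config A) : set (config A * config A) :=
  [set ab | [/\ stable_set q ab.1, stable_set q ab.2
              & asymp_u ab.1 ab.2]].

Definition G_u (q : config A) : eq_groupoid :=
  @EqGroupoid (config A) (G_u_arrows q)
    [set B | exists a b (L : int),
       [/\ G_u_arrows q (a, b), forall n, n < L -> a n = b n &
           B = [set zz | [/\ X zz.1 /\ X zz.2,
                             forall n, L <= n -> zz.1 n = a n /\ zz.2 n = b n &
                             forall n, n < L -> zz.1 n = zz.2 n]]]].

End Groupoids.

(** * The C*-algebra of a groupoid *)

(* The complex numbers, with the topology of the absolute value. *)
Definition complexes (R : realType) : numClosedFieldType := R[i].

(* The full C*-algebra of an etale groupoid [G]: the completion of the *-algebra
   [C_c(G)] in the norm [sup ||rho f||], where [rho] ranges over the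
   *-representations of [C_c(G)] on Hilbert spaces. *)
Section GroupoidCstar.
Variables (R : realType) (G : eq_groupoid).

(* Functions on the set of arrows are extended by zero to all pairs. *)
Definition pair_fun : Type := obj G * obj G -> complexes R.
Implicit Types f g : pair_fun.

Definition Cc : set pair_fun :=
  [set f : pair_fun | [/\ forall a, ~ arrows G a -> f a = 0,
               continuous (fun a : arrow G => f (set_val a)) &
               compact (closure [set a : arrow G | f (set_val a) != 0])]].

Definition fadd f g : pair_fun := fun a => f a + g a.
Definition fsub f g : pair_fun := fun a => f a - g a.
Definition fscale (c : complexes R) f : pair_fun := fun a => c * f a.
Definition fconv f g : pair_fun :=
  fun a => \sum_(y \in [set: obj G]) f (a.1, y) * g (y, a.2).
Definition fstar f : pair_fun := fun a => (f (a.2, a.1))^*.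

(* [dot] is an inner product on the Banach space [H] that induces its norm. *)
Definition is_hilbert (H : completeNormedModType (complexes R))
    (dot : {dot H for (@Num.conj (complexes R))}) : Prop :=
  forall v : H, `|v| ^+ 2 = dot v v.

(* The values of [rho] outside [C_c(G)] are irrelevant. *)
Definition star_representation (H : completeNormedModType (complexes R))
    (dot : {dot H for (@Num.conj (complexes R))}) (rho : pair_fun -> H -> H) : Prop :=
  [/\ forall f, Cc f -> linear (rho f) /\
        exists M : complexes R, forall v, `|rho f v| <= M * `|v|,
      forall f g, Cc f -> Cc g ->
        forall v, rho (fadd f g) v = rho f v + rho g v,
      forall c f, Cc f -> forall v, rho (fscale c f) v = c *: rho f v,
      forall f g, Cc f -> Cc g -> forall v, rho (fconv f g) v = rho f (rho g v) &
      forall f, Cc f -> forall v w, dot (rho (fstar f) v) w = dot v (rho f w)].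

Definition op_norm (H : completeNormedModType (complexes R)) (T : H -> H) : \bar R :=
  ereal_sup [set (complex.Re `|T v|)%:E | v in [set v : H | `|v| <= 1]].

Definition full_norm f : \bar R :=
  ereal_sup [set r | exists (H : completeNormedModType (complexes R))
      (dot : {dot H for (@Num.conj (complexes R))}) (rho : pair_fun -> H -> H),
    [/\ is_hilbert dot, star_representation dot rho & r = op_norm (rho f)]].

Definition cauchy_seq : set (nat -> pair_fun) :=
  [set u | (forall n, Cc (u n)) /\
     forall e : R, 0 < e -> exists N : nat, forall m n : nat,
       (N <= m)%N -> (N <= n)%N -> (full_norm (fsub (u m) (u n)) < e%:E)%E].

Definition same_limit (u v : nat -> pair_fun) : Prop :=
  forall e : R, 0 < e -> exists N : nat, forall n : nat,
    (N <= n)%N -> (full_norm (fsub (u n) (v n)) < e%:E)%E.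

(* An element of the completion is a class of Cauchy sequences. *)
Definition cstar_elt : Type := set (nat -> pair_fun).

Definition cauchy_class (u : nat -> pair_fun) : cstar_elt :=
  [set v | cauchy_seq v /\ same_limit v u].

Definition cstar : set cstar_elt := cauchy_class @` cauchy_seq.

Definition lift1 (op : pair_fun -> pair_fun) (x : cstar_elt) : cstar_elt :=
  [set w | exists2 u, x u & cauchy_class (fun n => op (u n)) w].

Definition lift2 (op : pair_fun -> pair_fun -> pair_fun) (x y : cstar_elt) :
    cstar_elt :=
  [set w | exists u v,
     [/\ x u, y v & cauchy_class (fun n => op (u n) (v n)) w]].

Definition cstar_add := lift2 fadd.
Definition cstar_scale (c : complexes R) := lift1 (fscale c).
Definition cstar_mul := lift2 fconv.
Definition cstar_star := lift1 fstar.

End GroupoidCstar.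

Arguments cstar : clear implicits.

(* [C*(G)] and [C*(H)] are isomorphic as complex *-algebras; a *-isomorphism of
   C*-algebras is automatically isometric. *)
Definition cstar_isomorphic (R : realType) (G H : eq_groupoid) : Prop :=
  exists Phi : cstar_elt R G -> cstar_elt R H,
    [/\ set_bij (cstar R G) (cstar R H) Phi,
        forall x y, cstar R G x -> cstar R G y ->
          Phi (cstar_add x y) = cstar_add (Phi x) (Phi y),
        forall c x, cstar R G x ->
          Phi (cstar_scale c x) = cstar_scale c (Phi x),
        forall x y, cstar R G x -> cstar R G y ->
          Phi (cstar_mul x y) = cstar_mul (Phi x) (Phi y) &
        forall x, cstar R G x -> Phi (cstar_star x) = cstar_star (Phi x)].

(* Main.v *)
(** In the minimal right-resolving presentation distinct vertices have distinct
    follower sets: otherwise one could be merged into the other.  A word with the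
    fewest terminal vertices therefore has exactly one, [J], and mixing closes it
    up to a cycle at [J], whose periodic path is [q]; its label [p] is
    synchronizing.  A point with the left tail of [p] passes through [J] at
    infinitely many known negative times, so that right resolution determines its
    lift: [pi] is a bijection between the unstable sets of [q] and [p], and it
    matches their cylinders.  If [a] and [b] agree beyond [N], replacing the past
    of a point by that of [pi b] is a local conjugacy from [pi a] to [pi b].
    Conversely every local conjugacy has this form near a point, and so does its
    inverse; hence at a late time the two lifts are at vertices with the same
    followers, that is, at the same vertex, and they agree from then on.  The
    left-resolving half is the right-resolving one for the time reversal. *)

Require Import Defs.
From mathcomp Require Import all_boot all_order all_algebra.
From mathcomp Require Import all_classical all_reals all_analysis.
From mathcomp Require Import finmap complex zify.

Set Implicit Arguments.
Unset Strict Implicit.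
Unset Printing Implicit Defensive.

Import Order.TTheory GRing.Theory Num.Theory.
Import numFieldNormedType.Exports.

Local Open Scope classical_set_scope.
Local Open Scope ring_scope.

(** * Topology of configurations and arrows *)

Definition cylinder (A : finType) (x : config A) (k : nat) : set (config A) :=
  [set y | forall i : int, `|i| <= k%:Z -> y i = x i].

Lemma cylinder_nbhs (A : finType) (x : config A) k : nbhs x (cylinder x k).
Proof.
have coord i : nbhs x [set y : config A | y i = x i].
  apply: (@proj_continuous int (fun=> discrete_topology A) i x [set x i]).
  by apply: open_nbhs_nbhs; split => //; exact: discrete_open.
elim: k => [|k IH].
  by apply: filterS (coord 0) => y /= y0 i; rewrite normr_le0 => /eqP ->.
apply: filterS (filterI IH (filterI (coord k.+1%:Z) (coord (- k.+1%:Z)))).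
move=> y [yk [yp yn]] i ik /=.
have [|lt_ki] := lerP `|i| k%:Z; first exact: yk.
have [->|->] : i = k.+1%:Z \/ i = - k.+1%:Z by lia.
- exact: yp.
- exact: yn.
Qed.

(** In the product topology convergence of a filter is tested coordinate by coordinate, and the
    cylinder of radius [|i|] already fixes coordinate [i]. *)
Lemma nbhs_cylinder (A : finType) (x : config A) (W : set (config A)) :
  nbhs x W -> exists k, cylinder x k `<=` W.
Proof.
pose F : set_system (config A) := filter_from [set: nat] (cylinder x).
have FF : Filter F.
  apply: filter_from_filter; first by exists 0%N.
  move=> i j _ _; exists (maxn i j) => // y yij; split=> n nle; apply: yij; lia.
suff cvF : F --> x by move=> /cvF [k _ kW]; exists k.
apply/cvg_sup => i; apply/cvg_image.
  apply/seteqP; split => // a _; exists (fun=> a) => //.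
move=> U /= /nbhs_singleton Ui; exists (fun y => U (y i)); last first.
  apply/seteqP; split => [_ [y Uy <-] //|a Ua].
  by exists (fun=> a).
exists `|i|%N => // y /= /(_ i) -> //; lia.
Qed.

Lemma config_compact (A : finType) : compact [set: config A].
Proof.
rewrite (_ : setT = [set f : config A | forall i : int, [set: discrete_topology A] (f i)]).
  apply: (@tychonoff int (fun=> discrete_topology A) (fun=> setT)) => i.
  by apply: finite_compact; exact: (@finite_finset A).
by apply/seteqP; split.
Qed.

Definition mk_arrow (G : eq_groupoid) a (p : arrows G a) : arrow G :=
  exist _ a (mem_set p).

(** The family enters the topology as a subbase, so a neighbourhood contains a finite intersection
    of its members; each of them is pulled back at the one arrow [a]. *)
Lemma arrow_continuous (G H : eq_groupoid) (F : arrow G -> arrow H) :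
  (forall a B, Defs.basis H B -> B (set_val (F a)) ->
    exists B', [/\ Defs.basis G B', B' (set_val a) &
      forall c : arrow G, B' (set_val c) -> B (set_val (F c))]) ->
  continuous F.
Proof.
move=> FB a U [] P [] [] Q Qfin <- [] V QV Va PU.
have QU : V `<=` U by move=> b Vb; apply: PU; exists V.
have [L Lsub VL] := Qfin _ QV.
apply: (@filterS _ _ _ (F @^-1` V)); first exact: preimage_subset.
move: Va; rewrite -VL => Va.
rewrite preimage_bigcap; apply: filter_bigI => B LB.
have := set_mem (Lsub B LB); move=> [C HC CB].
have /FB : C (set_val (F a)) by rewrite -/((fun b : arrow H => C (set_val b)) (F a)) CB; exact: Va.
move=> /(_ HC) [B' [GB' B'a B'C]].
pose W (b : arrow G) := B' (set_val b).
have : nbhs a W.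
  exists W; split => //.
  exists [set W]; last by rewrite bigcup_set1.
  move=> _ ->; exists [fset W]%fset.
    by move=> D /fset1P ->; apply: mem_set; exists B'.
  by rewrite eqEsubset; split=> [b /(_ W (fset11 W))|b Wb D /fset1P ->].
by apply: filterS => c /B'C; rewrite -CB.
Qed.

(** * C*-algebras of isomorphic groupoids *)

(* [C_c] is only used through this property, which is closed under all operations;
   closure of [C_c] itself under convolution is never needed. *)
Definition vanishes (R : realType) (G : eq_groupoid) (f : pair_fun R G) :=
  forall a, ~ arrows G a -> f a = 0.

Lemma Cc_vanishes (R : realType) (G : eq_groupoid) (f : pair_fun R G) :
  Cc f -> vanishes f.
Proof. by case. Qed.

Section Transport.
Variables (R : realType) (G H : eq_groupoid).
Variables (F : arrow G -> arrow H) (F' : arrow H -> arrow G).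
Hypotheses (FK : cancel F F') (FK' : cancel F' F).
Hypotheses (F_cont : continuous F) (F'_cont : continuous F').

Definition transport (h : pair_fun R G) : pair_fun R H := fun b =>
  if pselect (arrows H b) is left p then h (set_val (F' (mk_arrow p))) else 0.

Lemma transport_vanishes h : vanishes (transport h).
Proof. by move=> b; rewrite /transport; case: pselect. Qed.

Lemma transport_val h (b : arrow H) : transport h (set_val b) = h (set_val (F' b)).
Proof.
rewrite /transport; case: pselect => [p|[]]; last exact: set_valP.
by congr (h (set_val (F' _))); apply: val_inj.
Qed.

Lemma transport_Cc h : Cc h -> Cc (transport h).
Proof.
case=> h0 hc hk; split.
- exact: transport_vanishes.
- rewrite (_ : (fun a => _) = (fun a => h (set_val a)) \o F').
    by move=> b; apply: continuous_comp; [exact: F'_cont|exact: hc].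
  by apply/funext => b; rewrite /= transport_val.
- set S := (X in closure X) in hk; set S' := (X in closure X).
  (* A homeomorphism carries the support of [h] onto that of its transport, and compactness passes
     to the image. *)
  suff -> : closure S' = F @` closure S.
    by apply: continuous_compact => //; exact: continuous_subspaceT.
  have S'E : S' = F' @^-1` S.
    by apply/seteqP; split => b; rewrite /S' /S /= transport_val.
  apply/seteqP; split => [b Sb|_ [a Sa <-]].
    exists (F' b) => // U /F'_cont /Sb [c [Sc Uc]].
    by exists (F' c); split => //; rewrite S'E in Sc.
  move=> U /F_cont /Sa [c [Sc Uc]]; exists (F c); split => //.
  by rewrite S'E /preimage /= FK.
Qed.

End Transport.

Lemma transportK (R : realType) (G H : eq_groupoid)
    (F : arrow G -> arrow H) (F' : arrow H -> arrow G) (h : pair_fun R G) :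
  cancel F F' -> vanishes h -> transport F (transport F' h) = h.
Proof.
move=> FK h0; apply/funext => a; have [Ga|nGa] := pselect (arrows G a); last first.
  by rewrite h0 // transport_vanishes.
rewrite -[a]/(set_val (mk_arrow Ga : arrow G)).
by rewrite !transport_val FK.
Qed.

Section CstarOfIso.
Variables (R : realType) (G H : eq_groupoid) (f : obj G -> obj H).
Variables (F : arrow G -> arrow H) (F' : arrow H -> arrow G).
Hypothesis FE : forall a, set_val (F a) = (f (set_val a).1, f (set_val a).2).
Hypotheses (FK : cancel F F') (FK' : cancel F' F).
Hypotheses (F_cont : continuous F) (F'_cont : continuous F').
Hypothesis symG : forall x y, arrows G (x, y) -> arrows G (y, x).
Hypothesis transG : forall x y z, arrows G (x, y) -> arrows G (y, z) -> arrows G (x, z).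

Local Notation T := (@transport R G H F').
Local Notation T' := (@transport R H G F).

Let TK h : vanishes h -> T' (T h) = h. Proof. exact: transportK. Qed.
Let TK' h : vanishes h -> T (T' h) = h. Proof. exact: transportK. Qed.

Lemma iso_arrows b : arrows H b <-> exists x y, arrows G (x, y) /\ b = (f x, f y).
Proof.
split=> [Hb|[x [y [Gxy ->]]]].
  pose c : arrow H := mk_arrow Hb.
  exists (set_val (F' c)).1, (set_val (F' c)).2; rewrite -surjective_pairing -FE FK'.
  by split => //; exact: set_valP.
pose a : arrow G := mk_arrow Gxy.
by have : arrows H (set_val (F a)) := set_valP (F a); rewrite FE.
Qed.

Lemma transport_map h x y : arrows G (x, y) -> T h (f x, f y) = h (x, y).
Proof.
move=> Gxy; pose a : arrow G := mk_arrow Gxy.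
by rewrite -[(f x, f y)](FE a) transport_val FK.
Qed.

(** The map [F] is injective on arrows, so an object is recovered from its unit [(x, x)], which
    symmetry and transitivity provide. *)
Lemma iso_inj x x' y y' : arrows G (x, y) -> arrows G (x', y') -> f x = f x' -> x = x'.
Proof.
have unit u v : arrows G (u, v) -> arrows G (u, u).
  by move=> Guv; apply: transG Guv (symG Guv).
move=> /unit Gx /unit Gx' fx.
pose a : arrow G := mk_arrow Gx.
pose a' : arrow G := mk_arrow Gx'.
have : set_val (F a) = set_val (F a') by rewrite !FE /= fx.
move=> /val_inj/(can_inj FK).
by move=> /(congr1 set_val) [].
Qed.

Lemma transport_fadd h k : T (fadd h k) = fadd (T h) (T k).
Proof.
apply/funext => b; rewrite /fadd.
have [/iso_arrows[x [y [Gxy ->]]]|nb] := pselect (arrows H b).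
  by rewrite !transport_map.
by rewrite !transport_vanishes // addr0.
Qed.

Lemma transport_fscale c h : T (fscale c h) = fscale c (T h).
Proof.
apply/funext => b; rewrite /fscale.
have [/iso_arrows[x [y [Gxy ->]]]|nb] := pselect (arrows H b).
  by rewrite !transport_map.
by rewrite !transport_vanishes // mulr0.
Qed.

Lemma transport_fstar h : T (fstar h) = fstar (T h).
Proof.
apply/funext => b; rewrite /fstar.
have [/iso_arrows[x [y [Gxy ->]]]|nb] := pselect (arrows H b).
  by rewrite !transport_map //=; exact: symG.
rewrite !transport_vanishes ?conjC0 // => /iso_arrows[x [y [Gxy [b2 b1]]]].
apply: nb; apply/iso_arrows; exists y, x; split; first exact: symG.
by rewrite [b]surjective_pairing b2 b1.
Qed.

Lemma transport_fconv h k : vanishes h -> vanishes k ->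
  T (fconv h k) = fconv (T h) (T k).
Proof.
move=> h0 k0; apply/funext => b; rewrite /fconv.
have [/iso_arrows[x [y [Gxy ->]]]|nb] := pselect (arrows H b); last first.
  (* A nonzero term would need composable arrows [(b.1, w)] and [(w, b.2)]; they come from
     composable arrows of [G], which would make [b] an arrow. *)
  rewrite transport_vanishes // fsbig1 // => w _.
  have [/iso_arrows[x [z [Gxz [b1 wz]]]]|?] := pselect (arrows H (b.1, w)); last first.
    by rewrite transport_vanishes // mul0r.
  have [/iso_arrows[z' [y [Gzy [wz' b2]]]]|?] := pselect (arrows H (w, b.2)); last first.
    by rewrite [T k _]transport_vanishes // mulr0.
  case: nb; apply/iso_arrows; exists x, y; split; last first.
    by rewrite [b]surjective_pairing b1 b2.
  have zz' : z = z' by apply: (iso_inj (symG Gxz) Gzy); rewrite -wz.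
  by apply: transG Gxz _; rewrite zz'.
(* Both sums range over all objects. They are cut down to the [z] joined to [x] by an arrow and to
   the images of these, between which [f] is a bijection. *)
rewrite transport_map //= -(fsbig_widen [set z | arrows G (x, z)]) //; last first.
  by move=> z /= [_ nz]; rewrite h0 // mul0r.
rewrite -[RHS](fsbig_widen (f @` [set z | arrows G (x, z)])) //; last first.
  move=> w /= [_ nw]; rewrite transport_vanishes ?mul0r // => /iso_arrows.
  move=> [x' [z [Gxz [xx' wz]]]]; apply: nw; exists z => //=.
  by rewrite (iso_inj Gxy Gxz xx').
rewrite fsbig_image.
  apply: eq_fsbigr => z /set_mem /= Gxz; rewrite !transport_map //.
  exact: transG (symG Gxz) Gxy.
move=> z z' /set_mem/= /symG Gz /set_mem/= /symG Gz'; exact: iso_inj Gz Gz'.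
Qed.

End CstarOfIso.

(** * Extension of star isomorphisms to the completions *)

Definition star_hom (R : realType) (G H : eq_groupoid)
    (T : pair_fun R G -> pair_fun R H) : Prop :=
  [/\ (forall h, vanishes (T h)) /\ (forall h, Cc h -> Cc (T h)),
      forall h k, vanishes h -> vanishes k -> T (fadd h k) = fadd (T h) (T k),
      forall c h, vanishes h -> T (fscale c h) = fscale c (T h),
      forall h k, vanishes h -> vanishes k -> T (fconv h k) = fconv (T h) (T k) &
      forall h, vanishes h -> T (fstar h) = fstar (T h)].

(** Composing a representation of [C_c(H)] with [T] gives one of [C_c(G)] with the same operator at
    [h], so the supremum for [h] runs over at least as many values. *)
Lemma full_norm_star_hom (R : realType) (G H : eq_groupoid)
    (T : pair_fun R G -> pair_fun R H) (h : pair_fun R G) :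
  star_hom T -> (full_norm (T h) <= full_norm h)%E.
Proof.
case=> [[_ TC] TD TZ TM Ts]; apply: ereal_sup_le => _ [V [dot [rho [Vh rep ->]]]].
exists V, dot, (fun k => rho (T k)); split => //.
case: rep => rl rD rZ rM rs; split.
- by move=> k Ck; apply: rl; exact: TC.
- by move=> k l Ck Cl v; rewrite TD ?rD //; by [exact: TC|exact: Cc_vanishes].
- by move=> c k Ck v; rewrite TZ ?rZ //; by [exact: TC|exact: Cc_vanishes].
- by move=> k l Ck Cl v; rewrite TM ?rM //; by [exact: TC|exact: Cc_vanishes].
- by move=> k Ck v w; rewrite Ts ?rs //; by [exact: TC|exact: Cc_vanishes].
Qed.

Section VanishingOperations.
Variables (R : realType) (G : eq_groupoid).
Implicit Types h k : pair_fun R G.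

Lemma fadd_vanishes h k : vanishes h -> vanishes k -> vanishes (fadd h k).
Proof. by move=> h0 k0 a na; rewrite /fadd h0 // k0 // addr0. Qed.

Lemma fscale_vanishes c h : vanishes h -> vanishes (fscale c h).
Proof. by move=> h0 a na; rewrite /fscale h0 // mulr0. Qed.

Lemma fsub_vanishes h k : vanishes h -> vanishes k -> vanishes (Defs.fsub h k).
Proof. by move=> h0 k0 a na; rewrite /Defs.fsub h0 // k0 // subr0. Qed.

Lemma fsubE h k : Defs.fsub h k = fadd h (fscale (-1) k).
Proof. by apply/funext => a; rewrite /Defs.fsub /fadd /fscale mulN1r. Qed.

Lemma fstar_vanishes h : (forall x y, arrows G (x, y) -> arrows G (y, x)) ->
  vanishes h -> vanishes (fstar h).
Proof.
move=> sym h0 [x y] na; rewrite /fstar h0 ?conjC0 //=.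
by move=> /sym.
Qed.

Lemma fconv_vanishes h k :
  (forall x y z, arrows G (x, y) -> arrows G (y, z) -> arrows G (x, z)) ->
  vanishes h -> vanishes k -> vanishes (fconv h k).
Proof.
move=> trans h0 k0 [x y] na; rewrite /fconv fsbig1 // => z _ /=.
have [Gxz|nxz] := pselect (arrows G (x, z)); last by rewrite h0 // mul0r.
by rewrite k0 ?mulr0 // => /(trans _ _ _ Gxz).
Qed.

End VanishingOperations.

Section CstarOfStarHom.
Variables (R : realType) (G H : eq_groupoid).
Variables (T : pair_fun R G -> pair_fun R H) (T' : pair_fun R H -> pair_fun R G).
Hypotheses (TP : star_hom T) (TP' : star_hom T').
Hypotheses (TK : forall h, vanishes h -> T' (T h) = h).
Hypotheses (TK' : forall h, vanishes h -> T (T' h) = h).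
Hypothesis symG : forall x y, arrows G (x, y) -> arrows G (y, x).
Hypothesis transG : forall x y z, arrows G (x, y) -> arrows G (y, z) -> arrows G (x, z).

Lemma full_norm_iso h : vanishes h -> full_norm (T h) = full_norm h.
Proof.
move=> h0; apply/eqP; rewrite eq_le full_norm_star_hom //=.
by rewrite -[in leLHS](TK h0) full_norm_star_hom.
Qed.

Lemma full_norm_fsub h k : vanishes h -> vanishes k ->
  full_norm (Defs.fsub (T h) (T k)) = full_norm (Defs.fsub h k).
Proof.
move=> h0 k0; case: TP => _ TD TZ _ _.
rewrite -[RHS]full_norm_iso; last exact: fsub_vanishes.
rewrite [in RHS]fsubE TD // ?TZ -?fsubE //; exact: fscale_vanishes.
Qed.

Definition cstar_map (x : cstar_elt R G) : cstar_elt R H :=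
  [set v | exists2 u, x u & v = (fun n => T (u n))].

Lemma cauchy_seq_vanishes (u : nat -> pair_fun R G) :
  cauchy_seq u -> forall n, vanishes (u n).
Proof. by move=> [uC _] n; exact: Cc_vanishes. Qed.

Lemma cauchy_seq_map (u : nat -> pair_fun R G) : (forall n, Cc (u n)) ->
  cauchy_seq u <-> cauchy_seq (fun n => T (u n)).
Proof.
case: TP => [[_ TC] _ _ _ _] uC.
split=> -[_ uc]; split=> [n|e e0].
- exact: TC.
- have [N uN] := uc e e0; exists N => m n Nm Nn.
  by rewrite full_norm_fsub; [exact: uN|exact: Cc_vanishes|exact: Cc_vanishes].
- exact: uC.
- have [N uN] := uc e e0; exists N => m n Nm Nn.
  by rewrite -full_norm_fsub; [exact: uN|exact: Cc_vanishes|exact: Cc_vanishes].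
Qed.

Lemma same_limit_map (u v : nat -> pair_fun R G) :
  (forall n, vanishes (u n)) -> (forall n, vanishes (v n)) ->
  same_limit (fun n => T (u n)) (fun n => T (v n)) <-> same_limit u v.
Proof.
move=> u0 v0; split=> uv e e0; have [N uvN] := uv e e0; exists N => n Nn.
  by rewrite -full_norm_fsub //; exact: uvN.
by rewrite full_norm_fsub //; exact: uvN.
Qed.

(** The termwise image is already a full class: a sequence on the right is the image of its termwise
    [T']-preimage, and [T] preserves the norms of differences. *)
Lemma cstar_map_class (u : nat -> pair_fun R G) : (forall n, vanishes (u n)) ->
  cstar_map (cauchy_class u) = cauchy_class (fun n => T (u n)).
Proof.
move=> u0; apply/seteqP; split=> [_ [v [vc vu] ->]|w [wc wu]].
  split; first by apply/cauchy_seq_map => //; case: vc.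
  by apply/same_limit_map => //; exact: cauchy_seq_vanishes.
have wE : w = (fun n => T (T' (w n))).
  by apply/funext => n; rewrite TK' //; apply: Cc_vanishes; case: wc.
have wC n : Cc (T' (w n)) by case: TP' wc => [[_ TC'] _ _ _ _] [wC _]; exact: TC'.
exists (fun n => T' (w n)) => //; rewrite wE in wc wu.
split; first exact/cauchy_seq_map.
by apply/same_limit_map => // n; exact: Cc_vanishes.
Qed.

Lemma cstar_vanishes (x : cstar_elt R G) u :
  cstar R G x -> x u -> forall n, vanishes (u n).
Proof. by move=> [u0 _ <-] [uc _]; exact: cauchy_seq_vanishes. Qed.

(** [lift1] is a union of classes of sequences [op (u n)]. All that [cstar_map_class] asks of these
    is to vanish off the arrows, which [op] preserves. *)
Lemma cstar_map_lift1 (op : pair_fun R G -> pair_fun R G) op' (x : cstar_elt R G) :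
  (forall h, vanishes h -> vanishes (op h)) ->
  (forall h, vanishes h -> T (op h) = op' (T h)) ->
  cstar R G x -> cstar_map (lift1 op x) = lift1 op' (cstar_map x).
Proof.
move=> op0 Top Cx.
have E u : x u -> cstar_map (cauchy_class (fun n => op (u n))) =
    cauchy_class (fun n => op' (T (u n))).
  move=> /(cstar_vanishes Cx) u0; rewrite cstar_map_class; last by move=> n; exact: op0.
  by congr cauchy_class; apply/funext => n; exact: Top.
apply/seteqP; split=> [_ [w [u xu uw] ->]|w [_ [u xu ->] uw]].
  by exists (fun n => T (u n)); [exists u|rewrite -E //; exists w].
by move: uw; rewrite -E // => -[v uv ->]; exists v => //; exists u.
Qed.

Lemma cstar_map_lift2 (op : pair_fun R G -> pair_fun R G -> pair_fun R G) op'
    (x y : cstar_elt R G) :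
  (forall h k, vanishes h -> vanishes k -> vanishes (op h k)) ->
  (forall h k, vanishes h -> vanishes k -> T (op h k) = op' (T h) (T k)) ->
  cstar R G x -> cstar R G y ->
  cstar_map (lift2 op x y) = lift2 op' (cstar_map x) (cstar_map y).
Proof.
move=> op0 Top Cx Cy.
have E u v : x u -> y v -> cstar_map (cauchy_class (fun n => op (u n) (v n))) =
    cauchy_class (fun n => op' (T (u n)) (T (v n))).
  move=> /(cstar_vanishes Cx) u0 /(cstar_vanishes Cy) v0.
  rewrite cstar_map_class; last by move=> n; exact: op0.
  by congr cauchy_class; apply/funext => n; exact: Top.
apply/seteqP; split=> [_ [w [u [v [xu yv uw]]] ->]|w [_ [_ [[u xu ->] [v yv ->] uw]]]].
  exists (fun n => T (u n)), (fun n => T (v n)); split; [by exists u|by exists v|].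
  by rewrite -E //; exists w.
by move: uw; rewrite -E // => -[w' uw' ->]; exists w' => //; exists u, v.
Qed.

Lemma cstar_isomorphic_star_hom : cstar_isomorphic R G H.
Proof.
have [[T0 TC] TD TZ TM Ts] := TP; have [[T0' TC'] _ _ _ _] := TP'.
exists cstar_map; split.
- split=> [_ [u uc <-]|x y Cx Cy xy|_ [w wc <-]].
  + rewrite cstar_map_class; last exact: cauchy_seq_vanishes.
    by exists (fun n => T (u n)) => //; apply/cauchy_seq_map => //; case: uc.
  + move: Cx Cy => /set_mem Cx /set_mem Cy.
    suff sub x' y' : cstar R G x' -> cstar R G y' -> cstar_map x' = cstar_map y' ->
      x' `<=` y' by apply/seteqP; split; apply: sub.
    move=> Cx' Cy' E u xu.
    have : cstar_map x' (fun n => T (u n)) by exists u.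
    rewrite E => -[v yv uv]; suff -> : u = v by [].
    apply/funext => n; rewrite -(TK (cstar_vanishes Cx' xu n)).
    by rewrite -(TK (cstar_vanishes Cy' yv n)) -[T (u n)]/((fun n => T (u n)) n) uv.
  + have wE : w = (fun n => T (T' (w n))).
      by apply/funext => n; rewrite TK' //; apply: Cc_vanishes; case: wc.
    have wC n : Cc (T' (w n)) by case: wc => wC _; exact: TC'.
    exists (cauchy_class (fun n => T' (w n))).
      by exists (fun n => T' (w n)) => //; apply/cauchy_seq_map => //; rewrite -wE.
    by rewrite cstar_map_class -?wE // => n; exact: Cc_vanishes.
- by move=> x y; apply: cstar_map_lift2 => // h k; exact: fadd_vanishes.
- by move=> c x; apply: cstar_map_lift1 => [h|h]; [exact: fscale_vanishes|exact: TZ].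
- by move=> x y; apply: cstar_map_lift2 => // h k; exact: fconv_vanishes.
- by move=> x; apply: cstar_map_lift1 => // h; exact: fstar_vanishes.
Qed.

End CstarOfStarHom.

Lemma cstar_isomorphic_square (R : realType) (G H : eq_groupoid)
    (f : obj G -> obj H) :
  (forall x y, arrows G (x, y) -> arrows G (y, x)) ->
  (forall x y z, arrows G (x, y) -> arrows G (y, z) -> arrows G (x, z)) ->
  square_is_iso f -> cstar_isomorphic R G H.
Proof.
move=> symG transG [F [FE [F' [FK FK' _ Fc Fc']]]].
pose T := @transport R G H F'; pose T' := @transport R H G F.
have TK h : vanishes h -> T' (T h) = h by exact: transportK.
have TK' h : vanishes h -> T (T' h) = h by exact: transportK.
have T0' h : vanishes (T' h) by exact: transport_vanishes.
have TP : star_hom T.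
  split.
  - by split=> h; [exact: transport_vanishes|exact: transport_Cc].
  - by move=> h k _ _; exact: transport_fadd FE FK FK' h k.
  - by move=> c h _; exact: transport_fscale FE FK FK' c h.
  - by move=> h k h0 k0; exact: (transport_fconv FE FK FK').
  - by move=> h _; exact: (transport_fstar FE FK FK').
have TP' : star_hom T'.
  (* Each identity for [T'] follows from the one for [T]: insert [T (T' h) = h] in the arguments and
     cancel the outer [T' (T _)]. *)
  have [_ TD TZ TM Ts] := TP; split.
  - by split=> h; [exact: transport_vanishes|exact: transport_Cc].
  - move=> h k h0 k0; rewrite -[in LHS](TK' h h0) -[in LHS](TK' k k0) -TD //.
    by rewrite TK //; exact: fadd_vanishes.
  - move=> c h h0; rewrite -[in LHS](TK' h h0) -TZ //.
    by rewrite TK //; exact: fscale_vanishes.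
  - move=> h k h0 k0; rewrite -[in LHS](TK' h h0) -[in LHS](TK' k k0) -TM //.
    by rewrite TK //; exact: fconv_vanishes.
  - move=> h h0; rewrite -[in LHS](TK' h h0) -Ts //.
    by rewrite TK //; exact: fstar_vanishes.
exact: (@cstar_isomorphic_star_hom R G H T T').
Qed.

(** * Paths and follower sets *)

Section Words.
Variable A : finType.
Implicit Types x y : config A.

Lemma size_word_at x i n : size (word_at x i n) = n.
Proof. by rewrite size_map size_iota. Qed.

Lemma word_at_cat x i m n :
  word_at x i (m + n) = word_at x i m ++ word_at x (i + m%:Z) n.
Proof.
rewrite /word_at iotaD map_cat add0n; congr cat.
by rewrite -[in LHS](addn0 m) iotaDl -map_comp; apply: eq_map => k /=; congr (x _); lia.
Qed.

Lemma word_atS x i n : word_at x i n.+1 = x i :: word_at x (i + 1) n.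
Proof. by rewrite -add1n word_at_cat /= addr0. Qed.

Lemma eq_word_at x y i j n :
  word_at x i n = word_at y j n <-> forall k : nat, (k < n)%N -> x (i + k%:Z) = y (j + k%:Z).
Proof.
split=> [e k kn|e]; last by apply/eq_in_map => k; rewrite mem_iota => /andP[_]; exact: e.
have := congr1 (nth (x (i + k%:Z)) ^~ k) e.
by rewrite !(nth_map 0%N) ?size_iota // !nth_iota.
Qed.

Lemma eq_window x y i n (j : int) :
  word_at x i n = word_at y i n -> i <= j -> j < i + n%:Z -> x j = y j.
Proof.
move=> /eq_word_at e ij jn; have := e `|j - i|%N.
by rewrite (_ : i + _ = j) => [->|]; [|lia|lia].
Qed.

Lemma word_at_shiftz x (n : int) i m : word_at (shiftz n x) i m = word_at x (i + n) m.
Proof. by apply/eq_word_at => k _; rewrite /shiftz; congr (x _); lia. Qed.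

Lemma shiftz_period x (P : nat) (k : nat) : shiftz P%:Z x = x -> shiftz (- (k * P)%N%:Z) x = x.
Proof.
move=> xP; elim: k => [|k IH]; apply/funext => i; rewrite /shiftz; first by rewrite mul0n addr0.
have xPi : x (i - (k.+1 * P)%N%:Z + P%:Z) = x (i - (k.+1 * P)%N%:Z).
  exact: (congr1 (fun y : config A => y (i - (k.+1 * P)%N%:Z)) xP).
have xi : x (i - (k * P)%N%:Z) = x i by exact: (congr1 (fun y : config A => y i) IH).
by rewrite -xPi -[RHS]xi; congr (x _); rewrite mulSn; lia.
Qed.

End Words.

Section Paths.
Variables (A : finType) (G : graph) (pi : edge G -> A).
Implicit Types (a b : config (edge G)) (v : vertex G) (P : set (edge G)).

Lemma edge_shift_shiftz a n : edge_shift G a -> edge_shift G (shiftz n a).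
Proof. by move=> Ga i; rewrite Ga /shiftz; congr (src (a _)); lia. Qed.

Definition glue a (s : int) b (t : int) : config (edge G) :=
  fun i => if i < s then a i else b (i - s + t).

Lemma edge_shift_glue a s b t : edge_shift G a -> edge_shift G b ->
  src (a s) = src (b t) -> edge_shift G (glue a s b t).
Proof.
move=> Ga Gb ab i; rewrite /glue.
have [is1|is1] := ltP (i + 1) s; first by rewrite (_ : i < s); [exact: Ga|lia].
have [i_s|i_s] := ltP i s.
  have -> : i + 1 = s by lia.
  by rewrite subrr add0r -ab Ga; congr (src (a _)); lia.
by rewrite Gb; congr (src (b _)); lia.
Qed.

(** Minimality counts vertices only, so [G] may have stranded edges; follower sets are taken along
    edges of bi-infinite paths. *)
Definition live (e : edge G) : Prop := exists2 a, edge_shift G a & exists i, a i = e.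

Lemma live_at e s : live e -> exists2 a, edge_shift G a & a s = e.
Proof.
move=> [a Ga [i ai]]; exists (shiftz (i - s) a); first exact: edge_shift_shiftz.
by rewrite /shiftz -ai; congr (a _); lia.
Qed.

(** The set [P] of permitted edges is [live] for follower sets and [setT] where only finite paths
    matter, as in [konig]. *)
Fixpoint follows P v (w : seq A) : Prop :=
  if w is c :: w' then exists e, [/\ P e, src e = v, pi e = c & follows P (tgt e) w']
  else True.

Lemma follows_sub P P' v w : P `<=` P' -> follows P v w -> follows P' v w.
Proof.
by move=> PP'; elim: w v => //= c w IH v [e [/PP' Pe sv pc /IH]]; exists e.
Qed.

Lemma follows_word a s n : edge_shift G a ->
  follows live (src (a s)) (word_at (label_map pi a) s n).
Proof.
move=> Ga; elim: n s => [//|n IH] s; rewrite word_atS /=.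
exists (a s); split=> //; first by exists a => //; exists s.
by rewrite Ga.
Qed.

(** Letter by letter, the future of the current path is replaced by that of a bi-infinite path
    through the next live edge; times before [s] are never touched. *)
Lemma follows_extend a s w : edge_shift G a -> follows live (src (a s)) w ->
  exists b, [/\ edge_shift G b, forall i, i < s -> b i = a i &
                word_at (label_map pi b) s (size w) = w].
Proof.
elim: w a s => [|c w IH] a s Ga /=; first by exists a.
move=> [e [/(live_at s)[d Gd ds] es ec ew]].
pose a1 := glue a s d s.
have a1s : a1 s = e by rewrite /a1 /glue ltxx -ds; congr (d _); lia.
have Ga1 : edge_shift G a1 by apply: edge_shift_glue; rewrite // ds.
have /IH [//|b [Gb ba1 bw]] : follows live (src (a1 (s + 1))) w by rewrite -Ga1 a1s.
exists b; split=> // [i i_s|].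
  by rewrite ba1 ?/a1 ?/glue ?i_s //; lia.
by rewrite word_atS bw /label_map ba1 ?a1s ?ec //; lia.
Qed.

(** A finite path is stored in a total function of time that is constrained on its window only; the
    end edges fill the other times, which is why the word is nonempty. *)
Lemma follows_path v c w s : follows setT v (c :: w) ->
  exists b, [/\ src (b s) = v,
    word_at (label_map pi b) s (size (c :: w)) = c :: w &
    forall i, s <= i -> i < s + (size w)%:Z -> tgt (b i) = src (b (i + 1))].
Proof.
elim: w v c s => [|d w IH] v c s [e [_ ev ec ew]].
  by exists (fun=> e); split=> //; [rewrite /word_at /label_map /= ec|move=> i /=; lia].
have [b [bs bw bp]] := IH _ _ (s + 1) ew.
exists (fun i => if i <= s then e else b i); split; first by rewrite lexx.
  rewrite [size _]/= word_atS {1}/label_map lexx ec -[in RHS]bw; congr cons.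
  apply/eq_word_at => k _; rewrite /label_map ifF //; lia.
move=> i i1 i2; rewrite [i + 1 <= s]leNgt.
have -> : s < i + 1 by lia.
have [i_s|i_s] := leP i s; first by rewrite (_ : i = s) ?bs //; lia.
by apply: bp; move: i2 => /=; lia.
Qed.

(** Compactness: paths that read longer and longer central windows of [x] accumulate at a
    bi-infinite path that reads all of [x]. *)
Lemma konig (x : config A) :
  (forall n : nat, exists v, follows setT v (word_at x (- n%:Z) (n + n).+2)) ->
  exists2 a, edge_shift G a & label_map pi a = x.
Proof.
move=> xP.
have path n : exists b, (forall i, `|i| <= n%:Z -> pi (b i) = x i) /\
    (forall i, `|i| <= n%:Z -> tgt (b i) = src (b (i + 1))).
  (* The window runs from [-n] to [n + 1], so that adjacency at time [n] is covered too. *)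
  have [v] := xP n; rewrite word_atS => /(follows_path (- n%:Z)) [b [_ bw bp]].
  exists b; rewrite -word_atS size_word_at in bw; rewrite size_word_at in bp.
  split=> i ni; last by apply: bp; lia.
  by apply: (eq_window bw); lia.
have [b bP] := choice path.
have [a [_ ab]] := @config_compact (edge G) (b @ \oo) _ (filterT : (b @ \oo) setT).
have near i : exists2 n : nat, `|i| <= n%:Z & b n i = a i /\ b n (i + 1) = a (i + 1).
  have Fi : (b @ \oo) [set c | exists2 n : nat, `|i| <= n%:Z & c = b n].
    exists `|i|%N => // n /= ni; exists n => //; lia.
  (* The radius [|i| + 1] fixes the edges at both [i] and [i + 1]. *)
  have [_ [[n ni ->] bn]] := ab _ _ Fi (cylinder_nbhs a (`|i|%N.+1)).
  by exists n => //; split; apply: bn; lia.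
exists a => [i|]; last apply/funext => i.
  by have [n ni [<- <-]] := near i; apply: (bP n).2.
by rewrite /label_map; have [n ni [<- _]] := near i; apply: (bP n).1.
Qed.

Hypothesis pi_rr : right_resolving pi.

Lemma right_resolving_src a b s n : edge_shift G a -> edge_shift G b ->
  src (a s) = src (b s) ->
  word_at (label_map pi a) s n = word_at (label_map pi b) s n ->
  src (a (s + n%:Z)) = src (b (s + n%:Z)).
Proof.
move=> Ga Gb; elim: n s => [|n IH] s; first by rewrite addr0.
rewrite !word_atS => ab [pab w].
have abs : a s = b s by exact: pi_rr.
have -> : s + n.+1%:Z = s + 1 + n%:Z by lia.
by apply: IH; rewrite // -Ga -Gb abs.
Qed.

Lemma right_resolving_eq a b s : edge_shift G a -> edge_shift G b ->
  src (a s) = src (b s) -> forall t,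
  (forall i, s <= i -> i <= t -> pi (a i) = pi (b i)) ->
  forall i, s <= i -> i <= t -> a i = b i.
Proof.
move=> Ga Gb ab t pab i si it; apply: pi_rr; last exact: pab.
have -> : i = s + `|i - s|%N%:Z by lia.
apply: right_resolving_src => //; apply/eq_word_at => k ki.
by apply: pab; lia.
Qed.

End Paths.

(** * Synchronization in the minimal presentation *)

Section FollowerSeparation.
Variables (A : finType) (X : set (config A)) (G : graph) (pi : edge G -> A).
Hypothesis G_min : minimal_right_resolving X pi.
Variables (I K : vertex G).
Hypothesis followsIK : forall w, follows pi (@live G) I w <-> follows pi (@live G) K w.
Hypothesis nIK : I != K.

(* [K] is deleted and the edges that enter it are redirected to [I]; restricting
   to live edges makes the hypothesis on [I] and [K], which only concerns
   prolongable paths, sufficient. *)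
Let V' := {v : vertex G | v != K}.
Let E' := {e : edge G | `[< live e >] && (src e != K)}.
Let redirect (v : vertex G) : V' := insubd (Sub I nIK : V') v.
Let G' := @Graph V' E' (fun e => redirect (src (val e))) (fun e => redirect (tgt (val e))).
Let pi' (e : edge G') : A := pi (val e).

Let redirectE v : v != K -> val (redirect v) = v.
Proof. by move=> vK; rewrite val_insubd vK. Qed.

Let follows_redirect v w :
  follows pi (@live G) (val (redirect v)) w <-> follows pi (@live G) v w.
Proof.
rewrite val_insubd; have [->|//] := eqVneq v K; exact: followsIK.
Qed.

Let srcE (e : edge G') : val (src e) = src (val e).
Proof. by case: e => e /= eP; rewrite redirectE //; case/andP: eP. Qed.

(** Seen in [G], a path of the merged graph may jump from [K] to [I]; equality of the follower sets
    carries the readable words across each jump. *)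
Let follows_merged b s n : edge_shift G' b ->
  follows pi (@live G) (val (src (b s))) (word_at (label_map pi' b) s n).
Proof.
move=> G'b; elim: n s => [//|n IH] s; rewrite word_atS /=.
exists (val (b s)); split; rewrite // ?srcE //.
  by have /andP[/asboolP] := valP (b s).
by apply/follows_redirect; have := IH (s + 1); rewrite -G'b.
Qed.

Let merged_follows v w : follows pi (@live G) (val v) w ->
  follows pi' setT v w.
Proof.
elim: w v => [//|c w IH] v /= [e [eL ev ec ew]].
have eP : `[< live e >] && (src e != K) by rewrite ev (valP v) andbT; apply/asboolP.
exists (Sub e eP); split=> //=.
  by apply: val_inj; rewrite /= redirectE ?ev //; exact: (valP v).
by apply: IH; apply/follows_redirect.
Qed.

(** The finite words of either graph can be read in the other, and [konig] turns this into equality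
    of the presented shifts. The merged graph is then a right-resolving presentation with one vertex
    fewer. *)
Lemma merge_contradiction : False.
Proof.
have [GX rr min] := G_min.
suff /min : presents X pi'.
  have -> : #|vertex G| = #|vertex G'|.+1.
    by rewrite card_sig (cardC1 K) prednK //; apply/card_gt0P; exists K.
  rewrite ltnn => no_rr; suff /no_rr : right_resolving pi' by [].
  move=> e e' ee' pee'; apply: val_inj; apply: rr => //.
  by rewrite -!srcE ee'.
rewrite -GX; apply/seteqP; split=> [_ [b G'b <-]|_ [a Ga <-]].
  apply: konig => n; exists (val (src (b (- n%:Z)))).
  by apply: (@follows_sub _ _ _ (@live G)) => //; exact: follows_merged.
apply: konig => n; exists (redirect (src (a (- n%:Z)))).
by apply: merged_follows; apply/follows_redirect; exact: follows_word.
Qed.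

End FollowerSeparation.

Lemma follower_separated (A : finType) (X : set (config A)) (G : graph)
    (pi : edge G -> A) (I K : vertex G) :
  minimal_right_resolving X pi ->
  (forall w, follows pi (@live G) I w <-> follows pi (@live G) K w) -> I = K.
Proof.
move=> Gmin IK; apply/eqP/negPn/negP => nIK.
exact: (merge_contradiction Gmin IK nIK).
Qed.

(** * Words with a single terminal vertex *)

Section Synchronization.
Variables (A : finType) (X : set (config A)) (G : graph) (pi : edge G -> A).
Hypothesis G_min : minimal_right_resolving X pi.

Let pi_rr : right_resolving pi. Proof. by case: G_min. Qed.

(** A word for which this set is a singleton is a magic word of the presentation. Only bi-infinite
    paths count, so that readings prolong on both sides. *)
Definition ends (w : seq A) : {set vertex G} :=
  [set v | `[< exists a s, [/\ edge_shift G a,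
      word_at (label_map pi a) s (size w) = w & src (a (s + (size w)%:Z)) = v] >]].

Lemma endsP w v : reflect (exists a s, [/\ edge_shift G a,
  word_at (label_map pi a) s (size w) = w & src (a (s + (size w)%:Z)) = v]) (v \in ends w).
Proof. by rewrite inE; exact: asboolP. Qed.

Lemma ends_cat w u v : v \in ends (w ++ u) -> exists a s, [/\ edge_shift G a,
  src (a s) \in ends w, word_at (label_map pi a) s (size u) = u & src (a (s + (size u)%:Z)) = v].
Proof.
move=> /endsP [a [s [Ga]]]; rewrite size_cat word_at_cat => /eqP.
rewrite eqseq_cat ?size_word_at // => /andP[/eqP aw /eqP au] av.
exists a, (s + (size w)%:Z); split=> //; first by apply/endsP; exists a, s.
by rewrite -av; congr (src (a _)); lia.
Qed.

(* Following a [u]-path backwards is injective by right resolution, and it misses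
   the vertex [v'], from which [u] cannot be read. *)
Lemma ends_shrink w u v v' : v \in ends w -> v' \in ends w ->
  follows pi (@live G) v u -> ~ follows pi (@live G) v' u ->
  ends (w ++ u) != finset.set0 /\ (#|ends (w ++ u)| < #|ends w|)%N.
Proof.
move=> /endsP [a [s [Ga aw av]]] v'w vu v'u; split.
  have /(follows_extend Ga) [b [Gb ba bu]] : follows pi (@live G) (src (a (s + (size w)%:Z))) u.
    by rewrite av.
  apply/set0Pn; exists (src (b (s + (size (w ++ u))%:Z))); apply/endsP; exists b, s; split=> //.
  rewrite size_cat word_at_cat bu; congr cat; rewrite -[RHS]aw.
  by apply/eq_word_at => k ks; rewrite /label_map ba //; lia.
have /choice [g gP] : forall t : vertex G, exists g, t \in ends (w ++ u) ->
    [/\ g \in ends w, g != v' & exists a s, [/\ edge_shift G a, src (a s) = g,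
      word_at (label_map pi a) s (size u) = u & src (a (s + (size u)%:Z)) = t]].
  move=> t; have [tw|ntw] := boolP (t \in ends (w ++ u)); last by exists t.
  have [b [r [Gb bw bu bt]]] := ends_cat tw; exists (src (b r)) => _.
  split=> //; last by exists b, r.
  by apply/eqP => bv'; apply: v'u; rewrite -bv' -bu; exact: follows_word.
rewrite [ltnRHS](cardsD1 v') v'w add1n ltnS -(@card_in_imset _ _ g).
  apply/subset_leq_card/fintype.subsetP => _ /imsetP[t tw ->].
  by have [gw gv' _] := gP t tw; apply/finset.setD1P.
move=> t t' tw t'w gt.
have [_ _ [b [r [Gb bg bu bt]]]] := gP t tw.
have [_ _ [b' [r' [Gb' bg' bu' bt']]]] := gP t' t'w.
(* This aligns the two [u]-paths at time [r]; starting at the same vertex with the same labels, they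
   end at the same vertex. *)
pose c := shiftz (r' - r) b'.
have Gc : edge_shift G c by exact: edge_shift_shiftz.
have := @right_resolving_src _ _ _ pi_rr b c r (size u) Gb Gc.
have cE k : c (r + k) = b' (r' + k) by rewrite /c /shiftz; congr (b' _); lia.
rewrite bt cE bt'; apply; first by rewrite -[r]addr0 cE !addr0 bg gt bg'.
rewrite bu -[in LHS]bu'; apply/eq_word_at => k _; by rewrite /label_map cE.
Qed.

(** While two terminal vertices remain, separation of follower sets gives a word readable from
    exactly one of them; appending it lowers their number without reaching zero. *)
Lemma focusing_word a0 : edge_shift G a0 -> exists w J, ends w = [set J]%SET.
Proof.
move=> Ga0.
suff shrink n w : (#|ends w| <= n)%N -> ends w != finset.set0 -> exists w J, ends w = [set J]%SET.
  apply: (shrink _ [::] (leqnn _)); apply/set0Pn; exists (src (a0 0)).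
  by apply/endsP; exists a0, 0.
elim: n w => [|n IH] w; first by rewrite leqn0 cards_eq0 => ->.
move=> wn w0; have [/cards1P ?|w1] := boolP (#|ends w| == 1%N); first by exists w.
have /card_gt1P [v [v' [vw v'w vv']]] : (1 < #|ends w|)%N.
  by rewrite ltn_neqAle eq_sym w1 card_gt0.
have shr t t' u : t \in ends w -> t' \in ends w ->
    follows pi (@live G) t u -> ~ follows pi (@live G) t' u -> exists w J, ends w = [set J]%SET.
  move=> tw t'w tu t'u; have [u0 us] := ends_shrink tw t'w tu t'u.
  by apply: (IH (w ++ u)) => //; rewrite -ltnS (leq_trans us).
have /existsNP [u] : ~ forall u, follows pi (@live G) v u <-> follows pi (@live G) v' u.
  by move=> /(follower_separated G_min) vv; rewrite vv eqxx in vv'.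
have [vu|vu] := pselect (follows pi (@live G) v u);
  have [v'u|v'u] := pselect (follows pi (@live G) v' u).
- by case.
- by move=> _; exact: shr vw v'w vu v'u.
- by move=> _; exact: shr v'w vw v'u vu.
- by case.
Qed.

End Synchronization.

(* Points of the unstable set of [label_map pi q] have at most one lift, and the
   lifts of two of them agree for as long as the points do. *)
Definition past_determines (A : finType) (G : graph) (pi : edge G -> A)
    (q : config (edge G)) : Prop :=
  forall a b M0 M, edge_shift G a -> edge_shift G b ->
    (forall n, n <= M0 -> label_map pi a n = label_map pi q n) ->
    (forall n, n <= M -> label_map pi a n = label_map pi b n) ->
    forall n, n <= M -> a n = b n.

(** * The periodic synchronizing path *)

Section SynchronizingCycle.
Variables (A : finType) (X : set (config A)) (G : graph) (pi : edge G -> A).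
Hypothesis G_min : minimal_right_resolving X pi.
Hypothesis X_mixing : mixing X.

Let XE x : X x <-> exists2 a, edge_shift G a & label_map pi a = x.
Proof. by case: G_min => <- _ _. Qed.

Lemma language_word a s n : edge_shift G a -> language X (word_at (label_map pi a) s n).
Proof.
move=> Ga; right; exists (label_map pi a); first by apply/XE; exists a.
by exists s; rewrite size_word_at.
Qed.

Lemma language_path w : language X w -> w != [::] ->
  exists a s, edge_shift G a /\ word_at (label_map pi a) s (size w) = w.
Proof.
move=> [-> //|[x /XE [a Ga <-] [s aw]] _]; by exists a, s.
Qed.

Lemma ends_eq w J a s : ends pi w = [set J]%SET -> edge_shift G a ->
  word_at (label_map pi a) s (size w) = w -> src (a (s + (size w)%:Z)) = J.
Proof. by move=> wJ Ga aw; apply/set1P; rewrite -wJ; apply/endsP; exists a, s. Qed.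

(** After [w] every path is at [J], so a path reading [uw] can be continued by the future of one
    reading [wv]. *)
Lemma ends_synchronizing w J : ends pi w = [set J]%SET -> synchronizing_word X w.
Proof.
move=> wJ.
have /endsP [a0 [s0 [Ga0 a0w _]]] : J \in ends pi w by rewrite wJ set11.
split; first by rewrite -a0w; exact: language_word.
move=> u v uw wv.
(* As [w] may be empty, empty [u] and [v] are settled first, so that [language_path] is applied to
   nonempty words. *)
have [->|u0] := eqVneq u [::]; first by [].
have [->|v0] := eqVneq v [::]; first by rewrite cats0.
have [|a [s [Ga]]] := language_path uw; first by case: u u0 {uw}.
rewrite size_cat word_at_cat => /eqP; rewrite eqseq_cat ?size_word_at // => /andP[/eqP au /eqP aw].
have [|b [t [Gb]]] := language_path wv; first by case: v v0 {wv} => // ? ? _; case: (w).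
rewrite size_cat word_at_cat => /eqP; rewrite eqseq_cat ?size_word_at // => /andP[/eqP bw /eqP bv].
pose r := s + (size u)%:Z + (size w)%:Z; pose r' := t + (size w)%:Z.
have Gc : edge_shift G (glue a r b r').
  by apply: edge_shift_glue; rewrite // (ends_eq wJ Ga aw) (ends_eq wJ Gb bw).
suff <- : word_at (label_map pi (glue a r b r')) s (size u + (size w + size v)) = u ++ w ++ v.
  exact: language_word.
rewrite !word_at_cat; congr cat; [rewrite -[RHS]au|congr cat; [rewrite -[RHS]aw|rewrite -[RHS]bv]].
- by apply/eq_word_at => k ku; rewrite /label_map /glue /r ifT //; lia.
- by apply/eq_word_at => k ku; rewrite /label_map /glue /r ifT //; lia.
- apply/eq_word_at => k ku; rewrite /label_map /glue /r ifF; last by lia.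
  by rewrite /r'; congr (pi (b _)); lia.
Qed.

Definition cycle_point (b : config (edge G)) (t : int) (P : nat) : config (edge G) :=
  fun i => b (t + (i %% P%:Z)%Z).

Lemma cycle_point_edge_shift b t P : (0 < P)%N -> edge_shift G b ->
  src (b (t + P%:Z)) = src (b t) -> edge_shift G (cycle_point b t P).
Proof.
move=> P0 Gb bP i; rewrite /cycle_point -(modzDml i) Gb.
have r0 : 0 <= (i %% P%:Z)%Z by apply: modz_ge0; lia.
have rP : (i %% P%:Z)%Z < P%:Z by apply: ltz_pmod; lia.
move: r0 rP; move: (i %% P%:Z)%Z => r r0 rP.
have [rP1|rP1] := ltP (r + 1) P%:Z.
  by rewrite modz_small ?addrA //; lia.
have -> : r + 1 = P%:Z by lia.
by rewrite modzz addr0 -bP; congr (src (b _)); lia.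
Qed.

Lemma cycle_point_period b t P : shiftz P%:Z (cycle_point b t P) = cycle_point b t P.
Proof. by apply/funext => i; rewrite /shiftz /cycle_point modzDr. Qed.

Lemma synchronizing_cycle : exists q, [/\ edge_shift G q,
  periodic_point (label_map pi q), synchronizing_point X (label_map pi q) &
  past_determines pi q].
Proof.
have [a0 Ga0] : exists a, edge_shift G a.
  have L0 : language X [::] by left.
  (* Mixing is applied to two empty words; the length [N.+1] makes the connecting word nonempty,
     hence read by some path. *)
  have [N /(_ N.+1 (leqnSn N)) [u [su _]]] := X_mixing L0 L0.
  rewrite cats0 /= => /language_path; case=> [|a [_ [Ga _]]]; last by exists a.
  by case: u su.
have [w [J wJ]] := focusing_word G_min Ga0.
have [Lw _] := ends_synchronizing wJ.
have [N /(_ N.+1 (leqnSn N)) [u [su _ Lwuw]]] := X_mixing Lw Lw.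
have [|b [s [Gb]]] := language_path Lwuw; first by case: u su {Lwuw} => // ? ? _; case: (w).
rewrite !size_cat !word_at_cat => /eqP; rewrite eqseq_cat ?size_word_at // => /andP[/eqP bw1].
rewrite eqseq_cat ?size_word_at // => /andP[/eqP bu /eqP bw2].
(* In the reading of [wuw], both ends of the final segment [uw] come just after a [w], hence lie at
   [J]. *)
pose P := (size u + size w)%N; pose t := s + (size w)%:Z.
have P0 : (0 < P)%N by rewrite /P su.
have bt : src (b t) = J by exact: ends_eq wJ Gb bw1.
have btP : src (b (t + P%:Z)) = J.
  by rewrite -(ends_eq wJ Gb bw2); congr (src (b _)); rewrite /t /P; lia.
pose q := cycle_point b t P.
have Gq : edge_shift G q by apply: cycle_point_edge_shift; rewrite // bt.
have qP : shiftz P%:Z (label_map pi q) = label_map pi q.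
  by have /(congr1 (label_map pi)) := cycle_point_period b t P.
(* Time 0 of [q] comes just after a [w], and periodicity puts a [w] just before every time [-kP]. *)
have qw0 : word_at (label_map pi q) (- (size w)%:Z) (size w) = w.
  rewrite -[RHS]bw2; apply/eq_word_at => k kw; rewrite /label_map /q /cycle_point.
  congr (pi (b _)); rewrite -modzDr modz_small; rewrite /t /P; lia.
have qw k : word_at (label_map pi q) (- (k * P)%N%:Z - (size w)%:Z) (size w) = w.
  rewrite -[RHS]qw0 -[in RHS](shiftz_period k qP) word_at_shiftz.
  by congr word_at; lia.
exists q; split=> //; first by exists P.
  exists w; first exact: ends_synchronizing wJ.
  by exists (- (size w)%:Z).
move=> a c M0 M Ga Gc aq ac n nM.
(* As [P] is positive, [-kP] is at most [n], [M0] and [M]; at that time both paths have just read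
   [w] and are at [J]. *)
pose k := (`|n| + `|M0| + `|M|)%N; pose r := - (k * P)%N%:Z.
have kP : (k <= k * P)%N by rewrite leq_pmulr.
have aw : word_at (label_map pi a) (r - (size w)%:Z) (size w) = w.
  rewrite -[RHS](qw k); apply/eq_word_at => j jw; apply: aq; rewrite /r.
  by move: kP; rewrite /k; lia.
have cw : word_at (label_map pi c) (r - (size w)%:Z) (size w) = w.
  rewrite -[RHS]aw; apply/eq_word_at => j jw; rewrite -ac // /r.
  by move: kP; rewrite /k; lia.
have [_ pi_rr _] := G_min.
have rE : r - (size w)%:Z + (size w)%:Z = r by lia.
have ar := ends_eq wJ Ga aw; have cr := ends_eq wJ Gc cw; rewrite rE in ar cr.
have src_r : src (a r) = src (c r) by rewrite ar cr.
apply: (right_resolving_eq pi_rr Ga Gc src_r (t := M)) => //.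
  by move=> i _ iM; exact: ac.
by rewrite /r; move: kP; rewrite /k; lia.
Qed.

End SynchronizingCycle.

(** * Local conjugacies *)

Section Distance.
Variables (R : realType) (A : finType).
Implicit Types x y : config A.

Lemma dist_eq x y n : (1 <= n)%N -> (forall i : int, `|i| < n%:Z -> x i = y i) ->
  dist R x y <= 2 ^- n.
Proof.
move=> n1 xy; rewrite /dist xy; last by rewrite normr0; lia.
rewrite eqxx; apply: ge_inf; last by exists n.
by exists 0 => _ [m _ <-]; rewrite invr_ge0 exprn_ge0.
Qed.

Lemma dist_ge0 x y : 0 <= dist R x y.
Proof.
rewrite /dist; case: eqP => // xy; apply: lb_le_inf.
  exists (2 ^- 1), 1%N => //; split=> // i i1.
  by rewrite (_ : i = 0) //; lia.
by move=> _ [m _ <-]; rewrite invr_ge0 exprn_ge0.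
Qed.

Lemma dist_le1 x y : dist R x y <= 1.
Proof.
have [xy|xy] := eqVneq (x 0) (y 0); last by rewrite /dist (negbTE xy).
apply: (@le_trans _ _ (2 ^- 1)); last by rewrite invf_le1 ?ler1n // exprn_gt0.
apply: dist_eq => // i i1; rewrite (_ : i = 0) //; lia.
Qed.

Lemma dist_lt1 x y : dist R x y < 1 -> x 0 = y 0.
Proof. by rewrite /dist; case: eqP => // _; rewrite ltxx. Qed.

End Distance.

Section Splice.
Variable A : finType.
Implicit Types x y z : config A.

Definition splice (N : int) y z : config A := fun n => if n <= N then y n else z n.

Lemma splice_continuous N y : continuous (splice N y).
Proof.
move=> z W /nbhs_cylinder [k kW]; apply: filterS (cylinder_nbhs z k) => t tz.
by apply: kW => i ik; rewrite /splice; case: ifP => // _; exact: tz.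
Qed.

End Splice.

Section LocalConjugacies.
Variables (R : realType) (A : finType) (X : set (config A)).
Variables (x y : config A) (N N' : nat) (g : config A -> config A).

(** A distance below 1 forces equality at coordinate 0, and the supremum makes the time uniform in
    [z]. *)
Lemma stable_local_conjugacy_agree : X x -> stable_local_conjugacy R X x N y N' g ->
  exists M : nat, forall z, local_u X x N z -> forall k : int, M%:Z <= k -> g z k = z k.
Proof.
move=> Xx [_ _ /cvgrPdist_lt /(_ 1 ltr01) [M _ supM]]; exists M => z Uz k Mk.
have := supM `|k|%N; rewrite /= => /(_ _)/wrap[]; first by lia.
rewrite sub0r normrN => /(le_lt_trans (ler_norm _)) sup1.
suff /dist_lt1 : dist R (shiftz `|k|%N%:Z z) (shiftz `|k|%N%:Z (g z)) < 1.
  by rewrite /shiftz add0r (_ : `|k|%N%:Z = k) //; lia.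
apply: le_lt_trans sup1; apply: ub_le_sup; last by exists z.
by exists 1 => _ [t _ <-]; exact: dist_le1.
Qed.

Lemma agree_sup_cvg (M : nat) : X x ->
  (forall z, local_u X x N z -> forall k : int, M%:Z < k -> g z k = z k) ->
  (fun n : nat => sup [set dist R (shiftz n%:Z z) (shiftz n%:Z (g z)) |
                        z in local_u X x N]) @ \oo --> (0 : R).
Proof.
move=> Xx zg; apply/cvgrPdist_le => e e0.
have [m me] : exists m : nat, 2 ^- m.+1 <= e :> R.
  have half : `|2^-1 : R| < 1 by rewrite ger0_norm ?invr_ge0 // invf_lt1 ?ltr1n.
  have /cvgrPdist_le /(_ e e0) [m _ me] := cvg_expr half.
  exists m; have := me m.+1; rewrite /= sub0r normrN exprVn ger0_norm ?invr_ge0 ?exprn_ge0 //.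
  by apply; lia.
(* At shift [n] the coordinates with [|i| < m + 1] sit at times [i + n > M], where [g z] and [z]
   agree. *)
exists (M + m).+2 => // n /= Mn; rewrite sub0r normrN.
have Dne : [set dist R (shiftz n%:Z z) (shiftz n%:Z (g z)) | z in local_u X x N] !=set0.
  by exists (dist R (shiftz n%:Z x) (shiftz n%:Z (g x))), x.
have supe : sup [set dist R (shiftz n%:Z z) (shiftz n%:Z (g z)) | z in local_u X x N] <= e.
  apply: ge_sup => // _ [z Uz <-]; apply: le_trans me.
  by apply: dist_eq => // i im; rewrite /shiftz zg //; lia.
rewrite ger0_norm //; apply: (@le_trans _ _ _ _ _ (dist_ge0 R (shiftz n%:Z x) (shiftz n%:Z (g x)))).
apply: ub_le_sup; last by exists x.
by exists 1 => _ [t _ <-]; exact: dist_le1.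
Qed.

Hypothesis Xx : X x.
Hypothesis xgy : stable_local_conjugacy R X x N y N' g.

(* Near [z0] a local conjugacy only depends on finitely many coordinates, so it
   replaces the past of [z] by that of [g z0]. *)
Lemma local_conjugacy_splice z0 : local_u X x N z0 ->
  exists k0 : nat, forall k : nat, (k0 <= k)%N -> forall z, X z ->
    (forall n : int, n <= k%:Z -> z n = z0 n) ->
    [/\ local_u X x N z, X (g z) & g z = splice k%:Z (g z0) z].
Proof.
move=> Uz0; have [M gM] := stable_local_conjugacy_agree Xx xgy.
have [[gc [V _ gU] _] _ _] := xgy.
have gV z : local_u X x N z -> local_u X y N' (g z).
  move=> Uz; have : (g @` local_u X x N) (g z) by exists z.
  by rewrite gU => -[].
have /subspace_continuousP/(_ _ Uz0)/(_ _ (cylinder_nbhs (g z0) M)) := gc.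
move=> /nbhs_cylinder [m mW]; exists (maxn M (maxn m N)) => k kk z Xz zz0.
have Uz : local_u X x N z by split=> // n nN; rewrite zz0 ?Uz0.2 //; lia.
split=> //; first by have [] := gV z Uz.
have /= zM : cylinder (g z0) M (g z).
  by apply: mW => // i im; apply: zz0; lia.
apply/funext => n; rewrite /splice; case: lerP => nk; last by apply: gM => //; lia.
(* From [M] on [g] changes nothing, up to [N'] both images have the past of [y], and in between
   continuity at [z0] applies. *)
have [nM|nM] := lerP M%:Z n; first by rewrite !gM // zz0.
have [nN|nN] := lerP n N'%:Z; first by rewrite (gV z Uz).2 // (gV z0 Uz0).2.
by apply: zM; lia.
Qed.

(** Openness of the image makes every point [z] near [y] a value [g t], and continuity of the
    inverse puts [t] near [x]; hence [t] is the splice, and it lies in [X]. *)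
Lemma local_conjugacy_splice_inv : exists k0 : nat, forall k : nat, (k0 <= k)%N ->
  forall z, X z -> (forall n : int, n <= k%:Z -> z n = y n) -> X (splice k%:Z x z).
Proof.
have [M gM] := stable_local_conjugacy_agree Xx xgy.
have [[gc [V oV gU] [h hc hg]] gx _] := xgy.
have Ux : local_u X x N x by [].
have gUy : (g @` local_u X x N) y by exists x.
have [_ Vy] : (local_u X y N' `&` V) y by rewrite -gU.
have /nbhs_cylinder [m mV] : nbhs y V by exact: open_nbhs_nbhs.
have /subspace_continuousP/(_ _ gUy)/(_ _ (cylinder_nbhs (h y) (maxn M N))) := hc.
move=> /nbhs_cylinder [m' mW]; exists (maxn (maxn M N) (maxn (maxn m m') N')) => k kk z Xz zy.
have : (local_u X y N' `&` V) z.
  by split; [split=> // n nN; apply: zy; lia|apply: mV => i im; apply: zy; lia].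
rewrite -gU => -[t Ut gt].
have hy : h y = x by rewrite -gx hg.
have ht : h z = t by rewrite -gt hg.
have /= zM : cylinder (h y) (maxn M N) (h z).
  by apply: mW; [move=> i im; apply: zy; lia|exists t].
suff -> : splice k%:Z x z = t by case: Ut.
apply/funext => n; rewrite /splice; case: lerP => nk; last by rewrite -gt gM //; lia.
have [nM|nM] := lerP M%:Z n; first by rewrite -(gM x) // gx -zy // -gt gM.
have [nN|nN] := lerP n N%:Z; first by rewrite Ut.2.
by rewrite -hy -ht zM //; lia.
Qed.

End LocalConjugacies.

(** * The isomorphism for right-resolving presentations *)

Section RightResolvingIso.
Variables (R : realType) (A : finType) (X : set (config A)).
Variables (G : graph) (pi : edge G -> A) (q : config (edge G)).
Hypothesis GX : presents X pi.
Hypothesis pi_rr : right_resolving pi.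
Hypothesis pi_sep : forall I K,
  (forall w, follows pi (@live G) I w <-> follows pi (@live G) K w) -> I = K.
Hypothesis Gq : edge_shift G q.
Hypothesis q_past : past_determines pi q.

Local Notation L := (label_map pi).
Local Notation Uq := (unstable_set (edge_shift G) q).
Local Notation Up := (unstable_set X (L q)).

Let XL a : edge_shift G a -> X (L a).
Proof. by move=> Ga; rewrite -GX; exists a. Qed.

Let asymp_label a : asymp_u a q -> asymp_u (L a) (L q).
Proof. by move=> [M aM]; exists M => n nM; rewrite /label_map aM. Qed.

Lemma unstable_set_label a : Uq a -> Up (L a).
Proof. by move=> [Ga aq]; split; [exact: XL|exact: asymp_label]. Qed.

Lemma unstable_set_lift y : Up y -> exists2 a, Uq a & L a = y.
Proof.
rewrite -[X]GX => -[[a Ga <-] [M aM]]; exists a => //; split=> //; exists M.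
exact: (q_past (M0 := M)).
Qed.

(** A lift exists because [pi] presents [X], and [past_determines] makes it agree with [a] as long
    as the labels do. *)
Lemma past_lift a y M : Uq a -> X y -> (forall n, n <= M -> y n = L a n) ->
  exists b, [/\ Uq b, L b = y & forall n, n <= M -> b n = a n].
Proof.
move=> [Ga aq]; rewrite -[X]GX => -[b Gb <-] ba.
have [M0 aM0] := aq.
have bL n : n <= M -> b n = a n.
  move=> nM; apply/esym; apply: (q_past (M0 := M0) (M := M)) => //.
    by move=> i iM; rewrite /label_map aM0.
  by move=> i iM; rewrite ba.
exists b; split=> //; split=> //; exists (Num.min M M0) => n.
by rewrite le_min => /andP[nM nM0]; rewrite bL // aM0.
Qed.

Lemma label_inj a b : Uq a -> Uq b -> L a = L b -> a = b.
Proof.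
move=> [Ga [M aM]] [Gb _] ab; apply/funext => n.
apply: (q_past (M0 := M) (M := n)) => //; first by move=> i iM; rewrite /label_map aM.
by rewrite ab.
Qed.

(** The seam is crossed through [a], which shares its edge at [N] with [c] and its edge at [N + 1]
    with [b]. *)
Lemma splice_edge_shift a b c (N : int) : edge_shift G a -> edge_shift G b ->
  edge_shift G c -> (forall n, n <= N -> c n = a n) -> (forall n, N < n -> a n = b n) ->
  edge_shift G (splice N b c).
Proof.
move=> Ga Gb Gc ca ab i; rewrite /splice.
have [i1N|i1N] := lerP (i + 1) N; first by rewrite ifT ?Gb //; lia.
case: lerP => iN; last exact: Gc.
by rewrite Gb -ab // -Ga -ca // Gc.
Qed.

Lemma asymp_u_splice a b (N : int) : asymp_u b q -> asymp_u (splice N b a) q.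
Proof.
move=> [M bM]; exists (Num.min M N) => n; rewrite le_min => /andP[nM nN].
by rewrite /splice nN bM.
Qed.

Lemma label_splice N b c : L (splice N b c) = splice N (L b) (L c).
Proof. by apply/funext => n; rewrite /label_map /splice; case: ifP. Qed.

(** The past is exchanged on the lift, where adjacency at the seam can be checked; labels then give
    the exchange in [X]. *)
Lemma local_lift a b (N : nat) z : Uq a -> Uq b ->
  (forall n, N%:Z < n -> a n = b n) -> local_u X (L a) N z ->
  exists c, [/\ Uq c, L c = z, forall n, n <= N%:Z -> c n = a n &
                Uq (splice N b c)].
Proof.
move=> Ua Ub ab [Xz za]; have [c [Uc cz ca]] := past_lift Ua Xz za.
exists c; split=> //; split; last by apply: asymp_u_splice; case: Ub.
by apply: (splice_edge_shift _ _ _ ca ab); [case: Ua|case: Ub|case: Uc].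
Qed.

Lemma splice_local_u a b (N : nat) z : Uq a -> Uq b ->
  (forall n, N%:Z < n -> a n = b n) -> local_u X (L a) N z ->
  local_u X (L b) N (splice N (L b) z).
Proof.
move=> Ua Ub ab /(local_lift Ua Ub ab) [c [_ <- _ [Gs _]]].
by split=> [|n nN]; [rewrite -label_splice; exact: XL|rewrite /splice nN].
Qed.

Lemma splice_spliceK N (x y z : config A) : (forall n, n <= N -> z n = x n) ->
  splice N x (splice N y z) = z.
Proof.
by move=> zx; apply/funext => n; rewrite /splice; case: (lerP n N) => // /zx.
Qed.

(** The inverse is the exchange of pasts in the other direction. The image is all of
    [local_u X (L b) N], so [setT] serves as the open set. *)
Lemma asymp_s_conjugacy a b (N : nat) : Uq a -> Uq b ->
  (forall n, N%:Z < n -> a n = b n) ->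
  stable_local_conjugacy R X (L a) N (L b) N (splice N (L b)).
Proof.
move=> Ua Ub ab; have ba n : N%:Z < n -> b n = a n by move=> /ab.
have Xa : X (L a) by apply: XL; case: Ua.
split.
- split; first by apply: continuous_subspaceT; exact: splice_continuous.
    exists setT; first exact: openT.
    rewrite setIT; apply/seteqP; split=> [_ [z Uz <-]|z Uz].
      exact: splice_local_u ab Uz.
    exists (splice N (L a) z); first exact: splice_local_u ba Uz.
    by apply: splice_spliceK; case: Uz.
  exists (splice N (L a)); first by apply: continuous_subspaceT; exact: splice_continuous.
  by move=> z [_ za]; exact: splice_spliceK.
- apply/funext => n; rewrite /splice; case: lerP => // /ab ab_n.
  by rewrite /label_map ab_n.
- apply: (@agree_sup_cvg _ _ _ _ _ _ N) => // z _ k Nk.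
  by rewrite /splice leNgt Nk.
Qed.

Lemma asymp_s_nat (T : finType) (x y : config T) : asymp_s x y ->
  forall m : nat, exists2 N : nat, (m <= N)%N & forall n, N%:Z < n -> x n = y n.
Proof.
by move=> [M xy] m; exists (maxn m `|M|%N); [exact: leq_maxl|move=> n Mn; apply: xy; lia].
Qed.

Lemma asymp_s_lcs a b : Uq a -> Uq b -> asymp_s a b -> lcs R X (L a) (L b).
Proof.
move=> Ua Ub /asymp_s_nat/(_ 0%N) [N _ ab].
by exists N, N, (splice N (L b)); exact: asymp_s_conjugacy.
Qed.

(** A readable word prolongs [a] to a new path. Trading the labels of its past for those of [b]
    stays in [X], and the lift of the result agrees with [b] up to [k], so it reads the word from
    the vertex of [b]. *)
Lemma splice_follows a b (k : nat) w : Uq a -> Uq b ->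
  (forall z, X z -> (forall n : int, n <= k%:Z -> z n = L a n) -> X (splice k (L b) z)) ->
  follows pi (@live G) (src (a (k%:Z + 1))) w -> follows pi (@live G) (src (b (k%:Z + 1))) w.
Proof.
move=> Ua Ub abX /(follows_extend (proj1 Ua)) [c [Gc ca cw]].
have Xs : X (splice k (L b) (L c)).
  by apply: abX; [exact: XL|move=> n nk; rewrite /label_map ca //; lia].
have [|d [[Gd _] dL db]] := past_lift (M := k) Ub Xs.
  by move=> n nk; rewrite /splice nk.
have [Gb _] := Ub.
rewrite -Gb -db // Gd -cw (_ : word_at _ _ _ = word_at (L d) (k%:Z + 1) (size w)).
  exact: follows_word.
apply/eq_word_at => j jw; rewrite dL /splice ifF //; lia.
Qed.

Lemma lcs_asymp_s a b : Uq a -> Uq b -> lcs R X (L a) (L b) -> asymp_s a b.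
Proof.
move=> Ua Ub [N [N' [g abg]]].
have Xa : X (L a) by apply: XL; case: Ua.
have Ula : local_u X (L a) N (L a) by [].
have [M gM] := stable_local_conjugacy_agree Xa abg.
have [k1 k1P] := local_conjugacy_splice Xa abg Ula.
have [k2 k2P] := local_conjugacy_splice_inv Xa abg.
pose k := maxn M (maxn k1 k2).
have [_ gab _] := abg.
have src_k : src (a (k%:Z + 1)) = src (b (k%:Z + 1)).
  (* One inclusion comes from the local conjugacy near [L a], the other from its inverse near
     [L b]. *)
  apply: pi_sep => w; split; apply: splice_follows => //.
    move=> z Xz za; have [|_ Xg gz] := k1P k _ z Xz za; first by rewrite /k; lia.
    by rewrite gab in gz; rewrite -gz.
  by apply: k2P; rewrite /k; lia.
(* From the common vertex on the labels agree, since [k] is at least [M], and right resolution makes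
   the edges agree. *)
exists (k%:Z + 1) => n kn.
have [[Ga _] [Gb _]] := (Ua, Ub).
apply: (right_resolving_eq pi_rr Ga Gb src_k (t := n)) => // i ki _.
by have := gM _ Ula i; rewrite gab /label_map => -> //; rewrite /k in ki *; lia.
Qed.

Let Gs := G_s (edge_shift G) q.
Let Gl := G_lcs R X (L q).

Let arrows_label (ab : arrow Gs) :
  arrows Gl (L (set_val ab).1, L (set_val ab).2).
Proof.
have [Ua Ub ab_s] : arrows Gs (set_val ab) := set_valP ab.
by split; [exact: unstable_set_label|exact: unstable_set_label|exact: asymp_s_lcs].
Qed.

Lemma square_is_iso_right : @square_is_iso Gs Gl L.
Proof.
pose F (ab : arrow Gs) : arrow Gl := mk_arrow (arrows_label ab).
have FE ab : set_val (F ab) = (L (set_val ab).1, L (set_val ab).2) by [].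
have FU (ab : arrow Gs) :
    [/\ Uq (set_val ab).1, Uq (set_val ab).2 & asymp_s (set_val ab).1 (set_val ab).2].
  by have : arrows Gs (set_val ab) := set_valP ab.
have F_surj (xy : arrow Gl) : exists ab, F ab = xy.
  have : arrows Gl (set_val xy) := set_valP xy.
  case E : (set_val xy) => [x y] [/= Ux Uy xyl].
  have [a Ua aL] := unstable_set_lift Ux; have [b Ub bL] := unstable_set_lift Uy.
  have ab : arrows Gs (a, b).
    by split=> //; apply: lcs_asymp_s; rewrite // aL bL.
  exists (mk_arrow ab); apply: val_inj; rewrite /= -[RHS]/(set_val xy) E.
  by rewrite -aL -bL.
have F_inj ab ab' : F ab = F ab' -> ab = ab'.
  move=> /(congr1 set_val); rewrite !FE => -[e1 e2]; apply: val_inj.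
  have [Ua Ub _] := FU ab; have [Ua' Ub' _] := FU ab'.
  rewrite -[LHS]/(set_val ab) -[RHS]/(set_val ab').
  rewrite [set_val ab]surjective_pairing [set_val ab']surjective_pairing.
  by congr pair; exact: label_inj.
have [F' F'K] := choice F_surj.
have FK : cancel F F' by move=> ab; apply: F_inj.
exists F; split=> //; exists F'; split=> //.
- split=> [ab bc ac [e1 e2 e3]|xy yz xz [e1 e2 e3]].
    by split; rewrite !FE /= ?e1 ?e2 ?e3.
  rewrite -(F'K xy) -(F'K yz) -(F'K xz) !FE /= in e1 e2 e3.
  have [U1 U2 _] := FU (F' xy); have [U3 U4 _] := FU (F' yz); have [U5 U6 _] := FU (F' xz).
  by split; exact: label_inj.
(* Near [z], the label of the first path, [g] exchanges pasts up to [k]. With [k] also beyond the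
   time from which the two paths agree, the graph of [g] contains the labels of a basic set. *)
- apply: arrow_continuous => ab B [x [N [N' [g [Ux Ugx xg ->]]]]] [z Uz zE].
  rewrite FE in zE; case: zE => z1 z2.
  have [Ua Ub ab_s] := FU ab.
  have [k0 k0P] := local_conjugacy_splice (proj1 Ux) xg Uz.
  have [k k0k abk] := asymp_s_nat ab_s k0.
  exists [set cd | [/\ edge_shift G cd.1 /\ edge_shift G cd.2,
            forall n, n <= k%:Z -> cd.1 n = (set_val ab).1 n /\ cd.2 n = (set_val ab).2 n &
            forall n, k%:Z < n -> cd.1 n = cd.2 n]]; split.
  + exists (set_val ab).1, (set_val ab).2, k%:Z; split=> //.
  + by split=> //; split; [case: Ua|case: Ub].
  + move=> cd [[Gc Gd] cdk cdk']; rewrite FE; exists (L (set_val cd).1).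
      have [||//] := k0P k k0k (L (set_val cd).1); first exact: XL.
      by move=> n nk; rewrite z1 /label_map (cdk n nk).1.
    congr pair.
    have [||_ _ ->] := k0P k k0k (L (set_val cd).1); first exact: XL.
      by move=> n nk; rewrite z1 /label_map (cdk n nk).1.
    apply/funext => n; rewrite /splice z2 /label_map.
    by case: lerP => nk; [rewrite (cdk n nk).2|rewrite cdk'].
(* The neighbourhood is the graph of the exchange of pasts between the labels of [a'] and [b']. Its
   points lift to [c] and [splice N b' c], which [label_inj] identifies with the values of [F']. *)
- apply: arrow_continuous => xy B [a [b [k [ab abk ->]]]] [[Ga' Gb'] abk1 abk2].
  have [Ua' Ub' _] := FU (F' xy).
  set a' := (set_val (F' xy)).1 in Ua' Ga' abk1 abk2 *.
  set b' := (set_val (F' xy)).2 in Ub' Gb' abk1 abk2 *.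
  pose N := `|k|%N.
  have abN n : N%:Z < n -> a' n = b' n by move=> Nn; apply: abk2; rewrite /N in Nn; lia.
  have conj := asymp_s_conjugacy Ua' Ub' abN; have [_ gLa _] := conj.
  exists [set (z, splice N (L b') z) | z in local_u X (L a') N]; split.
  + exists (L a'), N, N, (splice N (L b')); rewrite gLa.
    by split=> //; exact: unstable_set_label.
  + exists (L a'); first by split=> //; exact: XL.
    by rewrite gLa -[in RHS](F'K xy) FE.
  + move=> xy2 [z Uz zE]; have [c [Uc cz ca Us]] := local_lift Ua' Ub' abN Uz.
    have [U1 U2 _] := FU (F' xy2).
    move: zE; rewrite -[in RHS](F'K xy2) FE => -[e1 e2].
    have -> : set_val (F' xy2) = (c, splice N b' c).
      rewrite [LHS]surjective_pairing; congr pair; apply: label_inj => //.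
        by rewrite cz.
      by rewrite -e2 label_splice cz.
    have kN : k <= N%:Z by rewrite /N; lia.
    split=> [|n nk|n kn] /=; first by split; [case: Uc|case: Us].
      by rewrite ca ?/splice ?ifT ?(abk1 n nk).1 ?(abk1 n nk).2 //; apply: le_trans kN.
    rewrite /splice; case: lerP => // nN; rewrite ca //; exact: abk2.
Qed.

End RightResolvingIso.

(** * Time reversal *)

Section EqGroupoidIso.
Variables G H K : eq_groupoid.

Lemma square_is_iso_comp (f : obj G -> obj H) (g : obj H -> obj K) :
  square_is_iso f -> square_is_iso g -> square_is_iso (g \o f).
Proof.
move=> [F [FE [F' [FK FK' [Fh Fh'] Fc Fc']]]] [E [EE [E' [EK EK' [Eh Eh'] Ec Ec']]]].
exists (E \o F); split; first by move=> a; rewrite /= EE FE.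
exists (F' \o E'); split.
- exact: (@can_comp _ _ _ E F E' F').
- exact: (@can_comp _ _ _ F' E' F E).
- by split=> a b c /=; [move=> /Fh/Eh|move=> /Eh'/Fh'].
- by move=> a; apply: continuous_comp; [exact: Fc|exact: Ec].
- by move=> a; apply: continuous_comp; [exact: Ec'|exact: Fc'].
Qed.

Lemma square_is_iso_bij (f : obj G -> obj H) (g : obj H -> obj G) :
  cancel f g -> cancel g f ->
  (forall x y, arrows G (x, y) <-> arrows H (f x, f y)) ->
  (forall B, Defs.basis H B -> Defs.basis G [set a | B (f a.1, f a.2)]) ->
  (forall B, Defs.basis G B -> Defs.basis H [set b | B (g b.1, g b.2)]) ->
  square_is_iso f.
Proof.
move=> fK gK arr fB gB.
have P (a : arrow G) : arrows H (f (set_val a).1, f (set_val a).2).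
  by apply/arr; rewrite -surjective_pairing; exact: set_valP.
have P' (b : arrow H) : arrows G (g (set_val b).1, g (set_val b).2).
  by apply/arr; rewrite !gK -surjective_pairing; exact: set_valP.
pose F a := mk_arrow (P a); pose F' b := mk_arrow (P' b).
exists F; split=> //; exists F'; split.
- move=> a; apply: val_inj; rewrite -[LHS]/(g (f (set_val a).1), g (f (set_val a).2)).
  by rewrite !fK -surjective_pairing.
- move=> b; apply: val_inj; rewrite -[LHS]/(f (g (set_val b).1), f (g (set_val b).2)).
  by rewrite !gK -surjective_pairing.
- split=> [a b c [e1 e2 e3]|a b c [e1 e2 e3]].
    by split; rewrite /= ?e1 ?e2 ?e3.
  by split; rewrite /= ?e1 ?e2 ?e3.
- apply: arrow_continuous => a B HB Ba.
  by exists [set a | B (f a.1, f a.2)]; split=> //; exact: fB.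
- apply: arrow_continuous => b B GB Bb.
  by exists [set b | B (g b.1, g b.2)]; split=> //; exact: gB.
Qed.

End EqGroupoidIso.

Section Mirror.
Variable A : finType.
Implicit Types (x y p : config A) (X : set (config A)).

Definition mirror x : config A := fun i => x (- i).

Lemma mirrorK : involutive mirror.
Proof. by move=> x; apply/funext => i; rewrite /mirror opprK. Qed.

Lemma preimage_mirrorK X : mirror @^-1` (mirror @^-1` X) = X.
Proof. by apply/seteqP; split=> x; rewrite /preimage /= mirrorK. Qed.

Lemma mirror_continuous : continuous mirror.
Proof.
move=> x W /nbhs_cylinder [k kW]; apply: filterS (cylinder_nbhs x k) => t tx.
by apply: kW => i ik; apply: tx; lia.
Qed.

Lemma asymp_u_mirror x y : asymp_u (mirror x) (mirror y) <-> asymp_s x y.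
Proof.
split=> -[M xy]; exists (- M) => n nM; last by apply: xy; lia.
by have := xy (- n); rewrite /mirror opprK; apply; lia.
Qed.

Lemma asymp_s_mirror x y : asymp_s (mirror x) (mirror y) <-> asymp_u x y.
Proof. by rewrite -asymp_u_mirror !mirrorK. Qed.

Lemma stable_set_mirror X p x :
  stable_set X (mirror p) (mirror x) <-> unstable_set (mirror @^-1` X) p x.
Proof. by split=> -[Xx /asymp_s_mirror xp]; split=> //; exact/asymp_s_mirror. Qed.

Lemma dist_mirror (R : realType) x y : dist R (mirror x) (mirror y) = dist R x y.
Proof.
rewrite /dist /mirror oppr0; case: ifP => // _.
congr (inf (_ @` _)); apply/seteqP; split=> n [n1 xy]; split=> // i i_n; last first.
  by apply: xy; rewrite normrN.
by have := xy (- i); rewrite opprK normrN; exact.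
Qed.

Lemma shiftz_mirror n x : shiftz n (mirror x) = mirror (shiftz (- n) x).
Proof. by apply/funext => i; rewrite /shiftz /mirror opprD. Qed.

Lemma local_s_mirror X x N :
  local_s X (mirror x) N = mirror @^-1` local_u (mirror @^-1` X) x N.
Proof.
apply/seteqP; split=> y [Xy yx].
  split; first by rewrite /preimage /= mirrorK.
  by move=> n nN; rewrite {1}/mirror yx /mirror ?opprK //; lia.
split; first by move: Xy; rewrite /preimage /= mirrorK.
by move=> n nN; have := yx (- n); rewrite /mirror opprK; apply; lia.
Qed.

Lemma local_u_mirror X x N :
  local_u X (mirror x) N = mirror @^-1` local_s (mirror @^-1` X) x N.
Proof.
by rewrite -[in RHS](mirrorK x) local_s_mirror !preimage_mirrorK.
Qed.

Lemma within_mirror (U : set (config A)) (g : config A -> config A) :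
  {within U, continuous g} ->
  {within mirror @^-1` U, continuous (mirror \o g \o mirror)}.
Proof.
move=> /subspace_continuousP gc; apply/subspace_continuousP => x Ux W.
move=> /mirror_continuous /(gc _ Ux) Wg.
have {}Wg : nbhs (mirror x) [set t | U t -> W (mirror (g t))] := Wg.
exact: (mirror_continuous Wg).
Qed.

Lemma image_mirror (U : set (config A)) (g : config A -> config A) :
  (mirror \o g \o mirror) @` (mirror @^-1` U) = mirror @^-1` (g @` U).
Proof.
apply/seteqP; split=> [_ [x Ux <-]|x [y Uy gy]].
  by exists (mirror x); rewrite //= mirrorK.
by exists (mirror y); rewrite /preimage /= !mirrorK // gy mirrorK.
Qed.

Lemma homeo_onto_open_mirror (U V : set (config A)) g : homeo_onto_open U V g ->
  homeo_onto_open (mirror @^-1` U) (mirror @^-1` V) (mirror \o g \o mirror).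
Proof.
move=> [gc [W oW gU] [h hc hg]]; split.
- exact: within_mirror.
- exists (mirror @^-1` W); first by apply: open_comp => // x _; exact: mirror_continuous.
  by rewrite image_mirror gU preimage_setI.
- exists (mirror \o h \o mirror); first by rewrite image_mirror; exact: within_mirror.
  by move=> z Uz /=; rewrite mirrorK hg // mirrorK.
Qed.

Lemma mirror_dist_set (R : realType) (U : set (config A)) g n :
  [set dist R (shiftz n z) (shiftz n ((mirror \o g \o mirror) z)) | z in mirror @^-1` U] =
  [set dist R (shiftz (- n) z) (shiftz (- n) (g z)) | z in U].
Proof.
apply/seteqP; split=> [_ [z Uz <-]|_ [z Uz <-]].
  exists (mirror z) => //=; rewrite -[in RHS](mirrorK z) !shiftz_mirror.
  by rewrite dist_mirror mirrorK.
exists (mirror z) => /=; first by rewrite /preimage /= mirrorK.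
by rewrite !shiftz_mirror dist_mirror mirrorK.
Qed.

Lemma unstable_local_conjugacy_mirror (R : realType) X x N y N' g :
  stable_local_conjugacy R (mirror @^-1` X) x N y N' g ->
  unstable_local_conjugacy R X (mirror x) N (mirror y) N' (mirror \o g \o mirror).
Proof.
move=> [gh gx gd]; split; rewrite ?local_s_mirror.
- exact: homeo_onto_open_mirror.
- by rewrite /= mirrorK gx.
- apply: cvg_trans gd; apply: near_eq_cvg; near=> n.
  by rewrite mirror_dist_set opprK.
Unshelve. all: by end_near. Qed.

Lemma stable_local_conjugacy_mirror (R : realType) X x N y N' g :
  unstable_local_conjugacy R (mirror @^-1` X) x N y N' g ->
  stable_local_conjugacy R X (mirror x) N (mirror y) N' (mirror \o g \o mirror).
Proof.
move=> [gh gx gd]; split; rewrite ?local_u_mirror.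
- exact: homeo_onto_open_mirror.
- by rewrite /= mirrorK gx.
- apply: cvg_trans gd; apply: near_eq_cvg; near=> n.
  by rewrite mirror_dist_set.
Unshelve. all: by end_near. Qed.

Lemma G_s_mirror X p : @square_is_iso (G_u X (mirror p)) (G_s (mirror @^-1` X) p) mirror.
Proof.
apply: (@square_is_iso_bij (G_u X (mirror p)) (G_s (mirror @^-1` X) p) _ mirror);
  [exact: mirrorK|exact: mirrorK| | |].
- move=> x y; split=> -[/= xp yp xy]; split=> /=.
  + by apply/stable_set_mirror; rewrite mirrorK.
  + by apply/stable_set_mirror; rewrite mirrorK.
  + exact/asymp_s_mirror.
  + by move/stable_set_mirror : xp; rewrite mirrorK.
  + by move/stable_set_mirror : yp; rewrite mirrorK.
  + exact/asymp_s_mirror.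
- move=> _ [a [b [L [[/= aq bq abs] ab ->]]]].
  (* The cuts [n <= L], [L < n] of [G_s] and [L <= n], [n < L] of [G_u] are mirror images, so the
     threshold is exactly [-L]. *)
  exists (mirror a), (mirror b), (- L); split.
  + by split=> /=; [exact/stable_set_mirror|exact/stable_set_mirror|exact/asymp_u_mirror].
  + by move=> n nL; apply: ab; lia.
  + apply/seteqP; split=> -[z z'] /= [[Xz Xz'] zL zL'].
      split=> [|n nL|n nL].
      * by move: Xz Xz'; rewrite /preimage /= !mirrorK.
      * by have := zL (- n); rewrite /mirror opprK; apply; lia.
      * by have := zL' (- n); rewrite /mirror opprK; apply; lia.
    split=> [|n nL|n nL]; first by rewrite /preimage /= !mirrorK.
      by have := zL (- n); rewrite /mirror opprK; apply; lia.
    by apply: zL'; lia.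
- move=> _ [a [b [L [[/= aq bq abs] ab ->]]]].
  exists (mirror a), (mirror b), (- L); split.
  + split=> /=; [| |exact/asymp_s_mirror].
      by apply/stable_set_mirror; rewrite mirrorK.
    by apply/stable_set_mirror; rewrite mirrorK.
  + by move=> n nL; apply: ab; lia.
  + apply/seteqP; split=> -[z z'] /= [[Xz Xz'] zL zL'].
      split=> [|n nL|n nL] //.
        by have := zL (- n); rewrite /mirror opprK; apply; lia.
      by have := zL' (- n); rewrite /mirror opprK; apply; lia.
    split=> [|n nL|n nL] //.
      by have := zL (- n); rewrite /mirror opprK; apply; lia.
    by apply: zL'; lia.
Qed.

Lemma G_lcs_mirror (R : realType) X p :
  (* Directed opposite to [G_s_mirror], so that the isomorphism for the mirrored shift fits between
     the two. *)
  @square_is_iso (G_lcs R (mirror @^-1` X) p) (G_lcu R X (mirror p)) mirror.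
Proof.
have conj_eq (g : config A -> config A) x : (mirror \o g \o mirror) (mirror x) = mirror (g x).
  by rewrite /= mirrorK.
have unm g : mirror \o (mirror \o g \o mirror) \o mirror = g.
  by apply/funext => z; rewrite /= !mirrorK.
have graph (U : set (config A)) g :
    [set a | [set (z, g z) | z in U] (mirror a.1, mirror a.2)] =
    [set (z, (mirror \o g \o mirror) z) | z in mirror @^-1` U].
  apply/seteqP; split=> [[z z']|_ [z Uz <-]] /=.
    by move=> [w Uw [wz wz']]; exists z; rewrite /preimage /= -wz // wz' mirrorK.
  by exists (mirror z); rewrite //= mirrorK.
have unst x : unstable_set (mirror @^-1` X) p (mirror x) <-> stable_set X (mirror p) x.
  by rewrite -stable_set_mirror mirrorK.
apply: (@square_is_iso_bij (G_lcs R (mirror @^-1` X) p) (G_lcu R X (mirror p)) _ mirror);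
  [exact: mirrorK|exact: mirrorK| | |].
- move=> x y; split=> -[/= xp yp [N [N' [g xy]]]]; split=> /=.
  + exact/stable_set_mirror.
  + exact/stable_set_mirror.
  + by exists N, N', (mirror \o g \o mirror); exact: unstable_local_conjugacy_mirror.
  + exact/stable_set_mirror.
  + exact/stable_set_mirror.
  + exists N, N', (mirror \o g \o mirror); rewrite -[x]mirrorK -[y]mirrorK.
    by apply: stable_local_conjugacy_mirror; rewrite preimage_mirrorK.
- move=> _ [x [N [N' [g [/= xp gxp xg ->]]]]].
  exists (mirror x), N, N', (mirror \o g \o mirror); rewrite conj_eq; split.
  + exact/unst.
  + exact/unst.
  + by apply: stable_local_conjugacy_mirror; rewrite preimage_mirrorK.
  + by rewrite graph local_u_mirror preimage_mirrorK.
- move=> _ [x [N [N' [g [/= xp gxp xg ->]]]]].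
  exists (mirror x), N, N', (mirror \o g \o mirror); rewrite conj_eq; split.
  + exact/stable_set_mirror.
  + exact/stable_set_mirror.
  + exact: unstable_local_conjugacy_mirror.
  + by rewrite graph local_s_mirror.
Qed.

End Mirror.

Arguments mirror {A}.

(** * Words and presentations under time reversal *)

Section MirrorLanguage.
Variable A : finType.
Implicit Types (x p : config A) (X : set (config A)).

Lemma word_at_mirror x i n :
  word_at (mirror x) i n = rev (word_at x (- i - n%:Z + 1) n).
Proof.
elim: n i => [//|n IH] i; rewrite word_atS IH -[in RHS]addn1 word_at_cat rev_cat /=.
rewrite /mirror; congr (x _ :: rev (word_at x _ n)); lia.
Qed.

Lemma occurs_in_mirror w x : occurs_in w (mirror x) <-> occurs_in (rev w) x.
Proof.
suff half (v : seq A) (y : config A) : occurs_in v (mirror y) -> occurs_in (rev v) y.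
  split=> [|wx]; first exact: half.
  by rewrite -[w]revK; apply: half; rewrite mirrorK.
move=> [i vi]; exists (- i - (size v)%:Z + 1).
by rewrite size_rev [in LHS]vi word_at_mirror revK.
Qed.

Lemma language_mirror X w : language (mirror @^-1` X) w <-> language X (rev w).
Proof.
split=> -[w0|[x Xx wx]].
- by left; rewrite w0.
- by right; exists (mirror x) => //; apply/occurs_in_mirror; rewrite revK.
- by left; rewrite -[w]revK w0.
- right; exists (mirror x); first by rewrite /preimage /= mirrorK.
  exact/occurs_in_mirror.
Qed.

Lemma mixing_mirror X : mixing X -> mixing (mirror @^-1` X).
Proof.
move=> mX w v /language_mirror Lw /language_mirror Lv.
have [N NP] := mX _ _ Lv Lw; exists N => n Nn.
have [u [un Lu Lvuw]] := NP n Nn; exists (rev u).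
split; rewrite ?size_rev //; apply/language_mirror; first by rewrite revK.
by rewrite !rev_cat revK -catA.
Qed.

Lemma synchronizing_point_mirror X p :
  synchronizing_point (mirror @^-1` X) p -> synchronizing_point X (mirror p).
Proof.
move=> [w [Lw sw] wp]; exists (rev w); last by apply/occurs_in_mirror; rewrite revK.
split; first exact/language_mirror.
move=> u v uw wv.
rewrite -[u ++ rev w ++ v]revK; apply/language_mirror.
rewrite !rev_cat revK -catA; apply: sw; apply/language_mirror; rewrite rev_cat revK //.
Qed.

Lemma periodic_point_mirror p : periodic_point p -> periodic_point (mirror p).
Proof.
move=> [n n0 pn]; exists n => //; apply/funext => i.
have /(congr1 (fun x : config A => x (- i - n%:Z))) := pn.
rewrite /shiftz /mirror => pi; rewrite opprD -pi; congr (p _); lia.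
Qed.

End MirrorLanguage.

Definition opposite (G : graph) : graph := @Graph (vertex G) (edge G) (@tgt G) (@src G).

Lemma edge_shift_opposite G : edge_shift (opposite G) = mirror @^-1` edge_shift G.
Proof.
apply/seteqP; split=> a Ga i.
  have /= e := Ga (- i - 1).
  by rewrite /mirror (_ : - i = - i - 1 + 1) -?e ?opprD //; lia.
have /= e := Ga (- i - 1); rewrite /mirror in e.
rewrite /= (_ : i + 1 = - (- i - 1)) ?e; last by lia.
by congr (@src G (a _)); lia.
Qed.

Lemma presents_opposite (A : finType) (X : set (config A)) (G : graph) (pi : edge G -> A) :
  presents X pi -> @presents A (mirror @^-1` X) (opposite G) pi.
Proof.
rewrite /presents edge_shift_opposite => <-; apply/seteqP; split=> [_ [a Ga <-]|x [a Ga ax]].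
  by exists (mirror a).
exists (mirror a); first by rewrite /preimage /= mirrorK.
by rewrite -[x]mirrorK -ax.
Qed.

(** Reversing the edges exchanges sources and targets, so the two resolving conditions coincide by
    definition; a competitor for the mirrored shift is reversed into one for [X]. *)
Lemma minimal_opposite (A : finType) (X : set (config A)) (G : graph) (pi : edge G -> A) :
  minimal_left_resolving X pi ->
  @minimal_right_resolving A (mirror @^-1` X) (opposite G) pi.
Proof.
move=> [GX lr min]; split; [exact: presents_opposite|by []|].
move=> H rho HX rr; apply: (min (opposite H) rho) => //.
by rewrite -[X]preimage_mirrorK; exact: presents_opposite.
Qed.

(** * Equivalence relations and assembly of the two halves *)

Lemma G_s_sym (A : finType) (X : set (config A)) q x y :
  arrows (G_s X q) (x, y) -> arrows (G_s X q) (y, x).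
Proof. by move=> [/= Ux Uy [M xy]]; split=> //=; exists M => n /xy ->. Qed.

Lemma G_s_trans (A : finType) (X : set (config A)) q x y z :
  arrows (G_s X q) (x, y) -> arrows (G_s X q) (y, z) -> arrows (G_s X q) (x, z).
Proof.
move=> [/= Ux Uy [M xy]] [/= _ Uz [M' yz]]; split=> //=; exists (Num.max M M') => n.
by rewrite ge_max => /andP[nM nM']; rewrite xy // yz.
Qed.

Lemma G_u_sym (A : finType) (X : set (config A)) q x y :
  arrows (G_u X q) (x, y) -> arrows (G_u X q) (y, x).
Proof. by move=> [/= Ux Uy [M xy]]; split=> //=; exists M => n /xy ->. Qed.

Lemma G_u_trans (A : finType) (X : set (config A)) q x y z :
  arrows (G_u X q) (x, y) -> arrows (G_u X q) (y, z) -> arrows (G_u X q) (x, z).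
Proof.
move=> [/= Ux Uy [M xy]] [/= _ Uz [M' yz]]; split=> //=; exists (Num.min M M') => n.
by rewrite le_min => /andP[nM nM']; rewrite xy // yz.
Qed.

Lemma right_resolving_isomorphism (R : realType) (A : finType) (X : set (config A))
    (G : graph) (pi : edge G -> A) : mixing X -> minimal_right_resolving X pi ->
  exists q : config (edge G), let p := label_map pi q in
    [/\ X p /\ periodic_point p, synchronizing_point X p,
        edge_shift G `&` [set a | label_map pi a = p] = [set q] &
        @square_is_iso (G_s (edge_shift G) q) (G_lcs R X p) (label_map pi)].
Proof.
move=> mX Gmin; have [GX rr _] := Gmin.
have [q [Gq qper qsync qpast]] := synchronizing_cycle Gmin mX; exists q; split=> //.
- by split=> //; rewrite -GX; exists q.
- apply/seteqP; split=> [a [Ga /= aq]|_ ->] //.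
  by apply/funext => n; apply: (qpast a q n n) => // i _; rewrite aq.
- apply: square_is_iso_right => // I K; exact: (follower_separated Gmin).
Qed.

Theorem theorem4p6 (R : realType) (A : finType) (X : set (config A))
    (X_sofic : sofic X) (X_mixing : mixing X) :
  (forall (G : graph) (pi : edge G -> A), minimal_right_resolving X pi ->
     exists (p : config A) (q : config (edge G)),
       [/\ X p /\ periodic_point p, synchronizing_point X p,
           edge_shift G `&` [set a | label_map pi a = p] = [set q],
           @square_is_iso (G_s (edge_shift G) q) (G_lcs R X p) (label_map pi) &
           cstar_isomorphic R (G_s (edge_shift G) q) (G_lcs R X p)])
  /\
  (forall (G' : graph) (pi' : edge G' -> A), minimal_left_resolving X pi' ->
     exists (p' : config A) (q' : config (edge G')),
       [/\ X p' /\ periodic_point p', synchronizing_point X p',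
           edge_shift G' `&` [set a | label_map pi' a = p'] = [set q'],
           @square_is_iso (G_u (edge_shift G') q') (G_lcu R X p')
             (label_map pi') &
           cstar_isomorphic R (G_u (edge_shift G') q') (G_lcu R X p')]).
Proof.
split=> G pi Gmin.
  have [q [Xp sp pq iso]] := right_resolving_isomorphism R X_mixing Gmin.
  exists (label_map pi q), q; split=> //.
  exact: cstar_isomorphic_square (@G_s_sym _ _ _) (@G_s_trans _ _ _) iso.
have [q [[Xp pp] sp pq iso]] :=
  right_resolving_isomorphism R (mixing_mirror X_mixing) (minimal_opposite Gmin).
have iso' : @square_is_iso (G_u (edge_shift G) (mirror q))
    (G_lcu R X (mirror (label_map pi q))) (label_map pi).
  have labelE : mirror \o (@label_map A G pi \o mirror) = label_map pi.
    by apply/funext => a; apply/funext => i; rewrite /= /label_map /mirror opprK.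
  rewrite edge_shift_opposite in iso.
  (* The composite passes from [G_u] to [G_s] of the mirrored edge shift, then to [G_lcs] of the
     mirrored [X], then to [G_lcu]; the two reversals cancel on labels. *)
  have iso_G := square_is_iso_comp (G_s_mirror (edge_shift G) q) iso.
  by have := square_is_iso_comp iso_G (G_lcs_mirror R X (label_map pi q)); rewrite labelE.
exists (mirror (label_map pi q)), (mirror q); split=> //.
- by split=> //; exact: periodic_point_mirror.
- exact: synchronizing_point_mirror.
- apply/seteqP; split=> [a [Ga /= ap]|_ ->].
    have : (edge_shift (opposite G) `&` [set b | label_map pi b = label_map pi q]) (mirror a).
      split; first by rewrite edge_shift_opposite /preimage /= mirrorK.
      by rewrite /= -[RHS]mirrorK -ap.
    by rewrite pq => /= <-; rewrite mirrorK.
  split=> //; have : [set q] q by [].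
  by rewrite -pq edge_shift_opposite => -[].
- exact: cstar_isomorphic_square (@G_u_sym _ _ _) (@G_u_trans _ _ _) iso'.
Qed.
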